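(* Let $s$ be a binary string of length $d-1$ (with $d\ge 1$). Let $(h_0,\dots,h_d)$ be the $h$-vector of the base polytope $P(s)$ of the snake matroid $M(s)$, and let $(h_0',\dots,h_d')$ be the $h$-vector of the independence complex of $M(s)$. Then $h'$ dominates $h$: for any $0\le j\le d$, $$\sum_{i=0}^jh_i\le\sum_{i=0}^jh_i'.$$
   Context: $M(s)$ is the matroid on $[d+1]$ obtained from $U_{1,2}$ on $\{1,2\}$ by reading $s$ left to right and, with $e$ the current largest element and $e'$ a new largest element, performing a parallel extension (bases $\mathcal B(M)\cup\{B-e+e'\mid e\in B\in\mathcal B(M)\}$) for each $0$ and a series extension (bases $\{B+e'\mid B\in\mathcal B(M)\}\cup\{B+e\mid e\notin B\in\mathcal B(M)\}$) for each $1$. Its base polytope is $P(s)=\mathrm{conv}\{\sum_{b\in B}e_b\mid B\in\mathcal B(M(s))\}\subset\mathbb R^{d+1}$, of dimension $d$. The $h$-vector of a $d$-dimensional polytope (not necessarily simple) with $f_i$ faces of dimension $i$ (including $f_d=1$) is defined by $\sum_{i=0}^dh_ix^i=\sum_{i=0}^df_i(x-1)^i$. The $h$-vector of the independence complex of a matroid of rank $r$ is the usual one for simplicial complexes: if $g_i$ is the number of independent sets of size $i$, then $\sum_{i=0}^rh_i'x^{r-i}=\sum_{i=0}^rg_i(x-1)^{r-i}$; it is extended by $h_i'=0$ for $r<i\le d$. *)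

(* Defs.v *)
From HB Require Import structures.
From mathcomp Require Import all_boot all_order all_algebra.

Set Implicit Arguments.
Unset Strict Implicit.
Unset Printing Implicit Defensive.

Import Order.TTheory GRing.Theory Num.Theory.

Local Open Scope set_scope.

Record matroid (T : finType) := Matroid {
  bases : {set {set T}};
  bases_neq0 : bases != set0;
  basis_exchange : forall B1 B2, B1 \in bases -> B2 \in bases ->
    forall x, x \in B1 :\: B2 ->
    exists2 y, y \in B2 :\: B1 & y |: (B1 :\ x) \in bases
}.

Definition indep (T : finType) (M : matroid T) : {set {set T}} :=
  [set I : {set T} | [exists B in bases M, I \subset B]].

Definition rank (T : finType) (M : matroid T) : nat :=
  \max_(B in bases M) #|B|.

Section U12.

Definition U12_bases : {set {set 'I_2}} := [set B : {set 'I_2} | #|B| == 1].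

Lemma U12_neq0 : U12_bases != set0.
Proof. by apply/set0Pn; exists [set ord0]; rewrite inE cards1. Qed.

Lemma U12_exchange B1 B2 : B1 \in U12_bases -> B2 \in U12_bases ->
  forall x, x \in B1 :\: B2 ->
  exists2 y, y \in B2 :\: B1 & y |: (B1 :\ x) \in U12_bases.
Proof.
rewrite !inE => /cards1P[a ->] /cards1P[b ->] x.
rewrite !inE => /andP[xb /eqP xa]; exists b; first by rewrite !inE -xa eq_sym xb eqxx.
by rewrite inE xa setDv setU0 cards1.
Qed.

Definition U12 : matroid 'I_2 := Matroid U12_neq0 U12_exchange.

End U12.

(* The ground set [n + 1] is 'I_n.+1, its element k being the ordinal k - 1.
   Enlarging the ground set to [n + 2], [lift ord_max] is the value-preserving
   inclusion 'I_n.+1 -> 'I_n.+2; the element e is [ord_max : 'I_n.+1] and the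
   new element e' is [ord_max : 'I_n.+2]. *)
Section Extension.
Variables (n : nat) (M : matroid 'I_n.+1).

Definition incl (B : {set 'I_n.+1}) : {set 'I_n.+2} := lift ord_max @: B.

Definition parallel_bases : {set {set 'I_n.+2}} :=
  [set incl B | B in bases M] :|:
  [set ord_max |: incl (B :\ ord_max) | B in bases M & ord_max \in B].

Definition series_bases : {set {set 'I_n.+2}} :=
  [set ord_max |: incl B | B in bases M] :|:
  [set incl (ord_max |: B) | B in bases M & ord_max \notin B].

Let mem_incl B i : (lift ord_max i \in incl B) = (i \in B).
Proof. exact/mem_imset/lift_inj. Qed.

Let max_incl B : (ord_max \in incl B) = false.
Proof. by apply/imsetP=> -[i _ /eqP]; rewrite (negbTE (neq_lift _ _)). Qed.

Let lift_max i : (lift ord_max i == ord_max :> 'I_n.+2) = false.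
Proof. by rewrite eq_sym; exact/negbTE/neq_lift. Qed.

Let max_lift i : (ord_max == lift ord_max i :> 'I_n.+2) = false.
Proof. exact/negbTE/neq_lift. Qed.

Let liftE i j : (lift ord_max i == lift ord_max j :> 'I_n.+2) = (i == j).
Proof. exact/inj_eq/lift_inj. Qed.

Let memE := (mem_incl, max_incl, lift_max, max_lift, liftE, inE, eqxx, andbT, orbT, orbF).

Let coll (B : {set 'I_n.+2}) : {set 'I_n.+1} :=
  [set i | (lift ord_max i \in B) || (i == ord_max) && (ord_max \in B)].

Let parallelE B : (B \in parallel_bases) =
  ~~ ((lift ord_max ord_max \in B) && (ord_max \in B)) && (coll B \in bases M).
Proof.
apply/idP/andP => [|[]].
  rewrite inE => /orP[] /imsetP[C].
    move=> CM ->; rewrite !memE andbF; split=> //.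
    by rewrite (_ : coll _ = C)//; apply/setP => i; rewrite !memE andbF orbF.
  rewrite inE => /andP[CM eC] ->; rewrite !memE /=; split=> //.
  rewrite (_ : coll _ = C)//; apply/setP => i; rewrite !memE /=.
  by case: eqVneq => [->|_] //=; rewrite ?eC ?orbF.
move=> eB CM; rewrite inE; apply/orP.
case e'B : (ord_max \in B) eB => eB; [right|left]; apply/imsetP; exists (coll B) => //.
- by rewrite !inE CM e'B eqxx orbT.
- apply/setP => i; case: (unliftP ord_max i) => [j|] ->; rewrite !memE ?e'B//=.
  move: eB; rewrite andbT; case: (eqVneq j ord_max) => [->|_] /=; first by move/negbTE.
  by rewrite orbF.
- apply/setP => i; case: (unliftP ord_max i) => [j|] ->; rewrite !memE ?e'B//=.
  by rewrite andbF orbF.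
Qed.

Lemma parallel_neq0 : parallel_bases != set0.
Proof.
have /set0Pn[B BM] := bases_neq0 M; apply/set0Pn; exists (incl B).
by apply/setUP; left; apply/imsetP; exists B.
Qed.

Lemma parallel_exchange B1 B2 : B1 \in parallel_bases -> B2 \in parallel_bases ->
  forall x, x \in B1 :\: B2 ->
  exists2 y, y \in B2 :\: B1 & y |: (B1 :\ x) \in parallel_bases.
Proof.
rewrite !parallelE => /andP[n1 b1] /andP[n2 b2] x /setDP[x1 x2].
pose p (z : 'I_n.+2) : 'I_n.+1 := odflt ord_max (unlift ord_max z).
have pl i : p (lift ord_max i) = i by rewrite /p liftK.
have pm : p ord_max = ord_max by rewrite /p unlift_none.
have collE (B : {set 'I_n.+2}) : coll B = p @: B.
  apply/setP => i; rewrite inE; apply/orP/imsetP.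
    by case=> [?|/andP[/eqP-> ?]];
      [exists (lift ord_max i); rewrite ?pl | exists ord_max; rewrite ?pm].
  case=> z zB ->; case: (unliftP ord_max z) zB => [j|] -> zB; [left|right].
    by rewrite pl.
  by rewrite pm eqxx.
have inj1 : {in B1 &, injective p}.
  move=> u v; case: (unliftP ord_max u) => [i|] ->; case: (unliftP ord_max v) => [j|] ->;
    rewrite ?pl ?pm => // uB vB eq_uv; first by rewrite eq_uv.
  - by move: n1; rewrite -eq_uv uB vB.
  - by move: n1; rewrite eq_uv vB uB.
have nP (B : {set 'I_n.+2}) : {in B &, injective p} ->
    ~~ ((lift ord_max ord_max \in B) && (ord_max \in B)).
  move=> pI; apply/andP => -[a b]; have /(_ _)/eqP := pI _ _ a b.
  by rewrite pl pm memE => /(_ erefl).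
have swap (y : 'I_n.+2) : p y \notin p @: (B1 :\ x) -> p y |: (p @: B1 :\ p x) \in bases M ->
    y |: (B1 :\ x) \in parallel_bases.
  move=> yN yB; rewrite parallelE nP /=; last first.
    move=> u v /setU1P[->|uB] /setU1P[->|vB] // E.
    - by case/negP: yN; rewrite E imset_f.
    - by case/negP: yN; rewrite -E imset_f.
    - by move: uB vB => /setD1P[_ uB] /setD1P[_ vB]; exact: inj1.
  rewrite collE imsetU1 (_ : p @: (B1 :\ x) = p @: B1 :\ p x)//.
  apply/setP => i; apply/imsetP/setD1P => [[z /setD1P[zx zB] ->]|[ipx /imsetP[z zB iz]]].
    by split; [apply: contra_neq zx => /inj1-> | rewrite imset_f].
  by exists z => //; rewrite !inE zB andbT; apply: contra_neq ipx => <-.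
have [px2|px2] := boolP (p x \in p @: B2).
  case/imsetP: px2 => y yB2 pxy.
  have yN : p y \notin p @: (B1 :\ x).
    apply/imsetP => -[z /setD1P[zx zB]]; rewrite -pxy => /inj1 E.
    by rewrite E ?eqxx in zx.
  exists y.
    rewrite inE yB2 andbT; apply/negP => yB1.
    by move: x2; rewrite (inj1 _ _ x1 yB1 pxy) yB2.
  by apply: swap => //; rewrite -pxy setD1K ?imset_f// -collE.
rewrite !collE in b1 b2.
have [|z] := basis_exchange b1 b2 (x := p x); first by rewrite inE px2 imset_f.
case/setDP => /imsetP[y yB2 ->] yB1 zM; exists y.
  by rewrite inE yB2 andbT; apply: contra yB1 => /(imset_f p).
apply: swap => //; apply: contra yB1 => /imsetP[u /setD1P[_ uB] ->]; exact: imset_f.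
Qed.

Definition parallel_ext : matroid 'I_n.+2 :=
  Matroid parallel_neq0 parallel_exchange.

Let seriesE B : (B \in series_bases) =
  if ord_max \in B then lift ord_max @^-1: B \in bases M
  else (lift ord_max ord_max \in B) && (lift ord_max @^-1: B :\ ord_max \in bases M).
Proof.
rewrite inE; apply/orP/idP => [|].
  case=> /imsetP[C].
    move=> CM ->; rewrite !memE (_ : _ @^-1: _ = C)//.
    by apply/setP => i; rewrite !memE.
  rewrite inE => /andP[CM eC] ->; rewrite !memE /= (_ : _ :\ _ = C)//.
  by apply/setP => i; rewrite !memE; case: eqVneq => [->|] //; rewrite (negbTE eC).
case: ifPn => [e'B CM|e'B /andP[eB CM]]; [left|right]; apply/imsetP.
  exists (lift ord_max @^-1: B) => //; apply/setP => i.
  by case: (unliftP ord_max i) => [j|] ->; rewrite !memE.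
exists (lift ord_max @^-1: B :\ ord_max); first by rewrite inE CM !inE eqxx.
apply/setP => i; case: (unliftP ord_max i) => [j|] ->; rewrite !memE ?(negbTE e'B)//=.
by case: eqVneq => [->|].
Qed.

Lemma series_neq0 : series_bases != set0.
Proof.
have /set0Pn[B BM] := bases_neq0 M; apply/set0Pn; exists (ord_max |: incl B).
by apply/setUP; left; apply/imsetP; exists B.
Qed.

Lemma series_exchange B1 B2 : B1 \in series_bases -> B2 \in series_bases ->
  forall x, x \in B1 :\: B2 ->
  exists2 y, y \in B2 :\: B1 & y |: (B1 :\ x) \in series_bases.
Proof.
pose e : 'I_n.+2 := lift ord_max ord_max.
pose q (B : {set 'I_n.+2}) : {set 'I_n.+1} := lift ord_max @^-1: B.
rewrite (seriesE B1) (seriesE B2) => H1 H2 x /setDP[].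
case: (unliftP ord_max x) => [i|] -> x1 x2; last first.
  rewrite x1 (negbTE x2) in H1 H2; case/andP: H2 => e2 b2.
  have [e1|e1] := boolP (e \in B1); last first.
    exists e; first by rewrite inE e2 e1.
    rewrite seriesE !memE /= (_ : _ :\ _ = q B1)//; apply/setP => j; rewrite !memE.
    by case: eqVneq => [->|] //=; rewrite (negbTE e1).
  have [|y] := basis_exchange H1 b2 (x := ord_max); first by rewrite !inE e1 eqxx.
  rewrite !inE => /and3P[y1 yN y2] yM; exists (lift ord_max y); first by rewrite inE y2 y1.
  rewrite seriesE !memE /= e1 /= orbT (_ : _ :\ _ = y |: (q B1 :\ ord_max))//.
  apply/setP => j; rewrite !memE; case: (eqVneq j ord_max) => [->|]//=.
  by rewrite eq_sym (negbTE yN).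
have key (b2 : {set 'I_n.+1}) : b2 \in bases M -> b2 \subset q B2 -> i \notin b2 ->
    ord_max \in B1 -> exists2 y, y \in B2 :\: B1 & y |: (B1 :\ lift ord_max i) \in series_bases.
  move=> b2M b2S ib2 e'1; rewrite e'1 in H1.
  have [|y] := basis_exchange H1 b2M (x := i); first by rewrite !inE x1 ib2.
  rewrite !inE => /andP[y1 y2] yM; exists (lift ord_max y).
    by rewrite inE y1; move/subsetP: b2S => /(_ _ y2); rewrite inE.
  rewrite seriesE !memE /= e'1 (_ : _ @^-1: _ = y |: (q B1 :\ i))//.
  by apply/setP => j; rewrite !memE.
have [e'1|e'1] := boolP (ord_max \in B1).
  move: H2; case: ifPn => [_ b2|_ /andP[_ b2]]; apply: (key _ b2) => //.
  - by rewrite inE.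
  - exact: subD1set.
  - by rewrite !inE negb_and x2 orbT.
rewrite (negbTE e'1) in H1; case/andP: H1 => e1 b1.
have [ie|ie] := eqVneq i ord_max.
  move: H2; rewrite ie in x1 x2 *; rewrite (negbTE x2) /=; case: ifPn => // e'2 _.
  exists ord_max; first by rewrite inE e'2 e'1.
  rewrite seriesE !memE /= (_ : _ @^-1: _ = q B1 :\ ord_max)//.
  by apply/setP => j; rewrite !memE.
have fin (b2 : {set 'I_n.+1}) : b2 \in bases M -> b2 \subset q B2 -> i \notin b2 ->
    (ord_max \in b2 -> ord_max \in B2) ->
    exists2 y, y \in B2 :\: B1 & y |: (B1 :\ lift ord_max i) \in series_bases.
  move=> b2M b2S ib2 e2e'; have [|y] := basis_exchange b1 b2M (x := i).
    by rewrite !inE x1 ib2 ie.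
  rewrite !inE => /andP[y1 y2] yM.
  have [ye|ye] := eqVneq y ord_max.
    rewrite ye in y2 yM *; have e'2 := e2e' y2; exists ord_max; first by rewrite inE e'2 e'1.
    rewrite seriesE !memE /=.
    rewrite (_ : _ @^-1: _ = ord_max |: (q B1 :\ ord_max :\ i))//.
    apply/setP => j; rewrite !memE.
    by have [->|] := eqVneq j ord_max => //=; rewrite e1 eq_sym ie.
  exists (lift ord_max y).
    rewrite ye /= in y1; rewrite inE y1.
    by move/subsetP: b2S => /(_ _ y2); rewrite inE.
  rewrite seriesE !memE /= (negbTE e'1) e1 /= (eq_sym ord_max i) ie orbT /=.
  rewrite (_ : _ :\ _ = y |: (q B1 :\ ord_max :\ i))//.
  apply/setP => j; rewrite !memE.
  by have [->|] := eqVneq j ord_max => //=; rewrite andbF orbF eq_sym (negbTE ye).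
move: H2; case: ifPn => [e'2 b2|e'2 /andP[_ b2]]; apply: (fin _ b2) => //.
- by rewrite inE.
- exact: subD1set.
- by rewrite !inE negb_and x2 orbT.
- by rewrite !inE eqxx.
Qed.

Definition series_ext : matroid 'I_n.+2 := Matroid series_neq0 series_exchange.

End Extension.

(* [snake_prefix s k] is the matroid after reading the first k letters of s;
   the letter 1 is [true]. *)
Fixpoint snake_prefix (s : seq bool) (k : nat) : matroid 'I_k.+2 :=
  match k with
  | 0 => U12
  | k'.+1 => if nth false s k' then series_ext (snake_prefix s k')
             else parallel_ext (snake_prefix s k')
  end.

Definition snake (s : seq bool) : matroid 'I_(size s).+2 :=
  snake_prefix s (size s).

Local Open Scope ring_scope.

Section IndependenceComplex.
Variables (T : finType) (M : matroid T).

Definition nb_indep (i : nat) : nat := #|[set I in indep M | #|I| == i]|.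

Definition indep_h_poly : {poly int} :=
  \sum_(i < (rank M).+1) (nb_indep i)%:R *: ('X - 1) ^+ (rank M - i).

Definition indep_h (i : nat) : int :=
  if (i <= rank M)%N then indep_h_poly`_(rank M - i) else 0.

End IndependenceComplex.

Local Close Scope set_scope.

(* Imported only here, as set0, subset, ... shadow those of finset. *)
From mathcomp Require Import finmap boolp classical_sets cardinality reals.

Local Open Scope classical_set_scope.

Section Polytope.
Variables (R : realType) (n : nat).
Implicit Types (A P F : set 'rV[R]_n).

Definition conv A : set 'rV[R]_n :=
  [set x | exists m (p : 'I_m -> 'rV[R]_n) (w : 'I_m -> R),
    [/\ forall i, A (p i), forall i, 0 <= w i, \sum_i w i = 1 &
        x = \sum_i w i *: p i]].

Definition affine_hull A : set 'rV[R]_n :=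
  [set x | exists m (p : 'I_m -> 'rV[R]_n) (w : 'I_m -> R),
    [/\ forall i, A (p i), \sum_i w i = 1 & x = \sum_i w i *: p i]].

(* The empty set has no dimension in nat: the face of dimension -1 is thus
   never counted. *)
Definition has_dim A (k : nat) : Prop :=
  exists (x : 'rV[R]_n) (U : {vspace 'rV[R]_n}),
    \dim U = k /\ affine_hull A = [set x + u | u in [set` U]].

Definition is_face P F : Prop :=
  exists (c : 'rV[R]_n) (b : R),
    (forall x, P x -> \sum_i c ord0 i * x ord0 i <= b) /\
    F = P `&` [set x | \sum_i c ord0 i * x ord0 i = b].

(* [fset_set] returns the empty set on infinite sets; a polytope has only
   finitely many faces. *)
Definition nb_faces P (i : nat) : nat :=
  #|` fset_set [set F | is_face P F /\ has_dim F i] |.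

Definition polytope_h_poly P (d : nat) : {poly int} :=
  \sum_(i < d.+1) (nb_faces P i)%:R *: ('X - 1) ^+ i.

(* the entry h_i of the h-vector of P, for P of dimension d *)
Definition polytope_h P (d i : nat) : int := (polytope_h_poly P d)`_i.

Definition base_polytope (M : matroid 'I_n) : set 'rV[R]_n :=
  conv [set \sum_(b in B) delta_mx ord0 b | B in [set` bases M]].

End Polytope.

Arguments base_polytope R {n} M.

(* Main.v *)
Require Import Defs.
From mathcomp Require Import all_boot all_order all_algebra.
From mathcomp Require Import reals.
From mathcomp Require Import ring lra.

(** Both h-vectors satisfy a linear recursion along the string, and the two
recursions differ only by a correction with nonnegative coefficients.

Polytopes. Let [e] be the last coordinate. Reading a letter replaces the base
polytope [P] by a wedge over it: above each point [x] of [P] stands a segment,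
in the direction that moves weight between [e] and [e'], of length [x_e] for a
parallel and [1 - x_e] for a series extension ([base_polytope_ext]). A linear
functional on the wedge is affine along these segments, with the same slope on
all of them, so that its maximal face lies at their tops, at their bottoms, or
is a union of whole segments ([is_face_wedge]). A face [F] of [P] therefore
produces a top copy, a bottom copy and the wedge over [F], which has one more
dimension; the three coincide when all segments over [F] have length zero.
Let [f], [f0], [f1] be the sums of [('X - 1) ^+ dim F] over the nonempty faces,
over those on which [x_e] is constantly 0, and constantly 1. A parallel
extension gives
  [(f, f0, f1) -> ((1 + 'X) * f - 'X * f0, f, f1)],
a series extension the same with 0 and 1 exchanged ([snake_face_list]), and the
coefficients of [f] are the h-vector.

Matroids. Splitting the independent sets according to whether they contain [e]
writes the h-vector of the independence complex as the coefficients of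
[p + 'X * a], where a parallel extension gives [(p, a) -> (p + 'X * a, a)] and a
series extension [(p, a) -> (p, p + 'X * a)] ([snake_rank_gf]).

Comparison. In terms of [h = p + 'X * a], the series step for [(h, p, a)] is
exactly the step for [(f, f0, f1)], and the parallel step exceeds it by
[(1 - 'X) * ('X * a)] in the first component. Hence [h - f = (1 - 'X) * D] for
a polynomial [D] with nonnegative coefficients ([indep_face_defect]), and its
coefficient of index [j] is the difference of the sums of the first [j + 1]
entries. *)

Set Implicit Arguments.
Unset Strict Implicit.
Unset Printing Implicit Defensive.

Import Order.TTheory GRing.Theory Num.Theory.

Local Open Scope set_scope.
Local Open Scope ring_scope.

(** * The two recursions and their comparison *)

(** The components are the sums of [('X - 1) ^+ dim F] over all nonempty faces of
a base polytope, over those in the hyperplane where the last coordinate is 0,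
and over those where it is 1; [true] is a series extension. A face [F] yields a
top copy, a bottom copy and a wedge, hence the weight [2 + ('X - 1)]; the
subtracted term corrects it to 1 for the faces over which the wedge is flat. *)
Definition face_step (b : bool) (v : {poly int} * {poly int} * {poly int}) :=
  let: (f, f0, f1) := v in
  if b then ((1 + 'X) * f - 'X * f1, f0, f) else ((1 + 'X) * f - 'X * f0, f, f1).

Fixpoint face_polys (s : seq bool) (k : nat) : {poly int} * {poly int} * {poly int} :=
  if k is k'.+1 then face_step (nth false s k') (face_polys s k') else (1 + 'X, 1, 1).

(** For a matroid of rank [r], the components [(p, a)] are such that [p] and
['X * a] sum ['X ^+ i * (1 - 'X) ^+ (r - i)] over the independent sets of size [i]
that avoid, respectively contain, the last element. *)
Definition indep_step (b : bool) (v : {poly int} * {poly int}) :=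
  let: (p, a) := v in if b then (p, p + 'X * a) else (p + 'X * a, a).

Fixpoint indep_polys (s : seq bool) (k : nat) : {poly int} * {poly int} :=
  if k is k'.+1 then indep_step (nth false s k') (indep_polys s k') else (1, 1).

Definition indep_poly s k := (indep_polys s k).1 + 'X * (indep_polys s k).2.

Definition nneg_coefs (p : {poly int}) := forall i, 0 <= p`_i.

Lemma nneg_coefsD p q : nneg_coefs p -> nneg_coefs q -> nneg_coefs (p + q).
Proof. by move=> pN qN i; rewrite coefD addr_ge0. Qed.

Lemma nneg_coefsXM p : nneg_coefs p -> nneg_coefs ('X * p).
Proof. by move=> pN i; rewrite coefXM; case: ifP. Qed.

Lemma nneg_coefs0 : nneg_coefs 0.
Proof. by move=> i; rewrite coef0. Qed.

Lemma indep_polys_nneg s k :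
  nneg_coefs (indep_polys s k).1 /\ nneg_coefs (indep_polys s k).2.
Proof.
elim: k => [|k] /=; first by split=> i; rewrite coef1; case: eqP.
case: (indep_polys s k) => p a /= [pN aN].
by case: (nth _ _ _); split=> //=; apply: nneg_coefsD => //; apply: nneg_coefsXM.
Qed.

(** The three differences between the recursions are divisible by [1 - 'X]. With
[D], [D0], [D1] their quotients, a series step maps [D] to [D + 'X * (D - D1)] and a
parallel step to [D + 'X * (D - D0) + 'X * a], while [D] becomes the new [D1],
respectively [D0]. So the nonnegativity of [D] is preserved as soon as [D - D0]
and [D - D1] are known to be nonnegative too, and these are preserved as well. *)
Lemma indep_face_defect s k : exists D D0 D1 : {poly int},
  [/\ indep_poly s k - (face_polys s k).1.1 = (1 - 'X) * D,
      (indep_polys s k).1 - (face_polys s k).1.2 = (1 - 'X) * D0,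
      (indep_polys s k).2 - (face_polys s k).2 = (1 - 'X) * D1 &
      [/\ nneg_coefs D, nneg_coefs (D - D0) & nneg_coefs (D - D1)]].
Proof.
rewrite /indep_poly; elim: k => [|k [D [D0 [D1]]]] /=.
  exists 0, 0, 0; rewrite /= !subrr mulr0 mulr1 subrr; split=> //.
  by split; apply: nneg_coefs0.
have := indep_polys_nneg s k.
case: (indep_polys s k) => p a; case: (face_polys s k) => [[f f0] f1] /=.
move=> [_ aN] [E E0 E1 [DN D0N D1N]].
have Df : f = p + 'X * a - (1 - 'X) * D by rewrite -E; ring.
case: (nth _ _ _) => /=.
  exists (D + 'X * (D - D1)), D0, D; split=> //.
    by rewrite Df (_ : f1 = a - (1 - 'X) * D1); [ring | rewrite -E1; ring].
  have XN := nneg_coefsXM D1N; split; first exact: nneg_coefsD.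
    by rewrite addrAC; apply: nneg_coefsD.
  by rewrite addrAC subrr add0r.
exists (D + 'X * (D - D0) + 'X * a), D, D1; split=> //.
  by rewrite Df (_ : f0 = p - (1 - 'X) * D0); [ring | rewrite -E0; ring].
have uN : nneg_coefs ('X * (D - D0) + 'X * a) by apply: nneg_coefsD; apply: nneg_coefsXM.
rewrite -addrA; split; first exact: nneg_coefsD.
  by rewrite addrAC subrr add0r.
by rewrite addrAC; apply: nneg_coefsD.
Qed.

(** Division by [1 - 'X] forms prefix sums, which telescope. *)
Lemma sum_coef_1subX (R : nzRingType) (q : {poly R}) j :
  \sum_(i < j.+1) ((1 - 'X) * q)`_i = q`_j.
Proof.
elim: j => [|j IH]; first by rewrite big_ord_recr big_ord0 /= mulrBl mul1r coefB coefXM subr0 add0r.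
by rewrite big_ord_recr /= IH mulrBl mul1r coefB coefXM /= addrCA subrr addr0.
Qed.

Lemma face_indep_dominance s k j :
  \sum_(i < j.+1) (face_polys s k).1.1`_i <= \sum_(i < j.+1) (indep_poly s k)`_i.
Proof.
have [D [_ [_ [E _ _ [DN _ _]]]]] := indep_face_defect s k.
rewrite -subr_ge0 -sumrB; under eq_bigr do rewrite -coefB.
by rewrite E sum_coef_1subX.
Qed.

(** * Independent sets of parallel and series extensions *)

Lemma indepP (T : finType) (M : matroid T) (I : {set T}) :
  reflect (exists2 B, B \in bases M & I \subset B) (I \in indep M).
Proof.
by rewrite inE; apply: (iffP existsP) => [[B /andP[? ?]]|[B ? ?]]; exists B => //; apply/andP.
Qed.

Lemma leq_card_rank (T : finType) (M : matroid T) (I : {set T}) :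
  I \in indep M -> (#|I| <= rank M)%N.
Proof.
case/indepP=> B BM /subset_leq_card/leq_trans; apply.
exact: leq_bigmax_cond.
Qed.

Lemma setD1_notin (T : finType) (a : T) (A : {set T}) : a \notin A -> A :\ a = A.
Proof. by move=> aA; apply/setDidPl; rewrite disjoint_sym disjoints1. Qed.

Section Inclusion.
Variable n : nat.
Implicit Types (B I J : {set 'I_n.+1}) (K : {set 'I_n.+2}).

Lemma mem_incl B i : (lift ord_max i \in incl B) = (i \in B).
Proof. exact/mem_imset/lift_inj. Qed.

Lemma max_incl B : (ord_max \in incl B) = false.
Proof. by apply/imsetP=> -[i _ /eqP]; rewrite (negbTE (neq_lift _ _)). Qed.

Lemma max_neq_lift (i : 'I_n.+1) : (ord_max == lift ord_max i) = false.
Proof. exact/negbTE/neq_lift. Qed.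

Lemma lift_neq_max (i : 'I_n.+1) : (lift ord_max i == ord_max) = false.
Proof. by rewrite eq_sym max_neq_lift. Qed.

Definition inclE := (mem_incl, max_incl, max_neq_lift, lift_neq_max).

Lemma incl_subset B J : (incl B \subset incl J) = (B \subset J).
Proof.
apply/subsetP/subsetP => H i; first by rewrite -mem_incl => /H; rewrite mem_incl.
by case: (unliftP ord_max i) => [j|] ->; rewrite !inclE //; apply: H.
Qed.

Lemma max_incl_subset B J : (ord_max |: incl B \subset ord_max |: incl J) = (B \subset J).
Proof.
rewrite -incl_subset; apply/idP/idP; last exact: setUS.
by move/(setSD [set ord_max]); rewrite !setU1K ?max_incl.
Qed.

Lemma incl_subset_max B J : (incl B \subset ord_max |: incl J) = (B \subset J).
Proof.
by rewrite -incl_subset -subDset setD1_notin ?max_incl.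
Qed.

Lemma card_incl B : #|incl B| = #|B|.
Proof. exact/card_imset/lift_inj. Qed.

Lemma card_max_incl B : #|ord_max |: incl B| = #|B|.+1.
Proof. by rewrite cardsU1 max_incl card_incl. Qed.

(** Inverse to [incl] on the sets avoiding the new element, and to adding the new
element to [incl] on the others. *)
Definition restr K : {set 'I_n.+1} := lift ord_max @^-1: K.

Lemma restr_incl B : restr (incl B) = B.
Proof. by apply/setP=> i; rewrite inE mem_incl. Qed.

Lemma restr_max_incl B : restr (ord_max |: incl B) = B.
Proof. by apply/setP=> i; rewrite !inE lift_neq_max mem_incl. Qed.

Lemma incl_restr K : ord_max \notin K -> incl (restr K) = K.
Proof.
move=> eK; apply/setP=> i; case: (unliftP ord_max i) => [j|] ->.
  by rewrite mem_incl inE.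
by rewrite max_incl (negbTE eK).
Qed.

Lemma max_incl_restr K : ord_max \in K -> ord_max |: incl (restr K) = K.
Proof.
move=> eK; apply/setP=> i; case: (unliftP ord_max i) => [j|] ->.
  by rewrite !inE mem_incl inE inclE.
by rewrite !inE eqxx eK.
Qed.

Lemma big_incl (V : nmodType) (P : pred {set 'I_n.+2}) (f : {set 'I_n.+2} -> V) :
  \sum_(K | P K && (ord_max \notin K)) f K = \sum_(J | P (incl J)) f (incl J).
Proof.
rewrite (reindex_onto (@incl n) restr); last by move=> K /andP[_] /incl_restr.
by apply: eq_bigl => J; rewrite max_incl restr_incl eqxx !andbT.
Qed.

Lemma big_max_incl (V : nmodType) (P : pred {set 'I_n.+2}) (f : {set 'I_n.+2} -> V) :
  \sum_(K | P K && (ord_max \in K)) f K =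
  \sum_(J | P (ord_max |: incl J)) f (ord_max |: incl J).
Proof.
rewrite (reindex_onto (fun J => ord_max |: incl J) restr).
  by apply: eq_bigl => J; rewrite !inE eqxx restr_max_incl eqxx !andbT.
by move=> K /andP[_] /max_incl_restr.
Qed.

End Inclusion.

Lemma big_setU1 (T : finType) (a : T) (V : nmodType) (P : pred {set T}) (f : {set T} -> V) :
  \sum_(J | P (a |: J) && (a \notin J)) f (a |: J) = \sum_(J | P J && (a \in J)) f J.
Proof.
rewrite [RHS](reindex_onto (fun J => a |: J) (fun J => J :\ a)).
  apply: eq_bigl => J; rewrite !inE eqxx andbT; congr andb.
  apply/idP/eqP => [aJ|<-]; [by rewrite setU1K | by rewrite !inE eqxx].
by move=> J /andP[_ aJ]; rewrite setD1K.
Qed.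

Section ExtensionIndep.
Variables (n : nat) (M : matroid 'I_n.+1).
Implicit Types (B I J : {set 'I_n.+1}).

Lemma parallel_indep_incl J : (incl J \in indep (parallel_ext M)) = (J \in indep M).
Proof.
apply/indepP/indepP => [[B']|[B BM JB]]; last first.
  by exists (incl B); rewrite ?incl_subset // inE imset_f.
rewrite inE => /orP[] /imsetP[B].
  by move=> BM ->; rewrite incl_subset; exists B.
rewrite inE => /andP[BM eB] ->; rewrite incl_subset_max => JB.
by exists B => //; apply: subset_trans JB (subD1set _ _).
Qed.

Lemma parallel_indep_max J : (ord_max |: incl J \in indep (parallel_ext M)) =
  (ord_max |: J \in indep M) && (ord_max \notin J).
Proof.
apply/indepP/andP => [[B']|[/indepP[B BM]]]; last first.
  rewrite subUset sub1set => /andP[eB JB] eJ; exists (ord_max |: incl (B :\ ord_max)).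
    by rewrite inE; apply/orP; right; apply/imsetP; exists B; rewrite ?inE ?BM.
  by rewrite max_incl_subset subsetD1 JB.
rewrite inE => /orP[] /imsetP[B].
  by move=> BM ->; rewrite subUset sub1set max_incl.
rewrite inE => /andP[BM eB] ->; rewrite max_incl_subset subsetD1 => /andP[JB eJ].
by split=> //; apply/indepP; exists B; rewrite // subUset sub1set eB.
Qed.

Lemma series_indep_max J : (ord_max |: incl J \in indep (series_ext M)) = (J \in indep M).
Proof.
apply/indepP/indepP => [[B']|[B BM JB]]; last first.
  exists (ord_max |: incl B); rewrite ?max_incl_subset // inE; apply/orP; left.
  by apply/imsetP; exists B.
rewrite inE => /orP[] /imsetP[B].
  by move=> BM ->; rewrite max_incl_subset; exists B.
by rewrite inE => /andP[BM eB] ->; rewrite subUset sub1set max_incl.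
Qed.

(** If [J] lies in a basis containing [a], exchanging [a] for an element of a basis
that avoids it does not affect [J]. *)
Lemma indep_avoiding (a : 'I_n.+1) J B : B \in bases M -> a \notin B ->
  J \in indep M -> a \notin J -> exists2 B', B' \in bases M & (J \subset B') && (a \notin B').
Proof.
move=> BM aB /indepP[C CM JC] aJ.
have [aC|aC] := boolP (a \in C); last by exists C; rewrite ?JC.
have [|y] := basis_exchange CM BM (x := a); first by rewrite inE aB aC.
rewrite inE => /andP[yC yB] yM; exists (y |: (C :\ a)) => //.
rewrite !inE eqxx /= orbF; apply/andP; split; last by apply: contraNneq yC => <-.
by apply: subset_trans (subsetUr _ _); rewrite subsetD1 JC.
Qed.

Hypothesis max_not_coloop : exists2 B, B \in bases M & ord_max \notin B.

(** A basis of the series extension that avoids the new element contains the old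
last one for free. That the remainder extends to a basis avoiding that element
needs the latter not to be a coloop. *)
Lemma series_indep_incl J : (incl J \in indep (series_ext M)) = (J :\ ord_max \in indep M).
Proof.
apply/indepP/idP => [[B']|JM]; last first.
  have [B BM eB] := max_not_coloop.
  have [|C CM /andP[JC eC]] := indep_avoiding BM eB JM; first by rewrite !inE eqxx.
  exists (incl (ord_max |: C)); last by rewrite incl_subset -subDset.
  by rewrite inE; apply/orP; right; apply/imsetP; exists C; rewrite ?inE ?CM.
rewrite inE => /orP[] /imsetP[B].
  move=> BM ->; rewrite incl_subset_max => JB; apply/indepP; exists B => //.
  exact: subset_trans (subD1set _ _) JB.
rewrite inE => /andP[BM eB] ->; rewrite incl_subset => JB.
by apply/indepP; exists B; rewrite ?subDset.
Qed.

End ExtensionIndep.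

Section ExtensionRank.
Variables (n : nat) (M : matroid 'I_n.+1).

Lemma rank_parallel : rank (parallel_ext M) = rank M.
Proof.
apply/eqP; rewrite eqn_leq; apply/andP; split; apply/bigmax_leqP => B BM; last first.
  by rewrite -card_incl leq_card_rank // parallel_indep_incl; apply/indepP; exists B.
have : B \in indep (parallel_ext M) by apply/indepP; exists B.
have [eB|eB] := boolP (ord_max \in B).
  rewrite -(max_incl_restr eB) parallel_indep_max card_max_incl => /andP[IM eI].
  by have := leq_card_rank IM; rewrite cardsU1 eI.
by rewrite -(incl_restr eB) parallel_indep_incl card_incl; apply: leq_card_rank.
Qed.

Hypothesis max_not_coloop : exists2 B, B \in bases M & ord_max \notin B.

Lemma rank_series : rank (series_ext M) = (rank M).+1.
Proof.
apply/eqP; rewrite eqn_leq; apply/andP; split.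
  apply/bigmax_leqP => B BM; have : B \in indep (series_ext M) by apply/indepP; exists B.
  have [eB|eB] := boolP (ord_max \in B).
    by rewrite -(max_incl_restr eB) series_indep_max card_max_incl ltnS; apply: leq_card_rank.
  rewrite -(incl_restr eB) series_indep_incl // card_incl => /leq_card_rank.
  rewrite (cardsD1 ord_max (restr B)) -(add1n (rank M)) => cB.
  by apply: leq_add cB; case: (_ \in _).
(* A largest basis together with the new element attains the bound. *)
have [B BM rB] : exists2 B, B \in bases M & rank M = #|B|.
  have [|B BM rB] := @eq_bigmax_cond _ (mem (bases M)) (fun B : {set 'I_n.+1} => #|B|).
    exact/card_gt0P/set0Pn/bases_neq0.
  by exists B.
rewrite rB -card_max_incl leq_card_rank // series_indep_max.
by apply/indepP; exists B.
Qed.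

End ExtensionRank.

Section RankGenerating.
Variables (n : nat) (M : matroid 'I_n.+1).

(** Summing over sets rather than over sizes lets the bijections between
independent sets act directly on the terms. *)
Definition rank_gf (P : pred {set 'I_n.+1}) : {poly int} :=
  \sum_(I | (I \in indep M) && P I) ('X - 1) ^+ (rank M - #|I|).

Definition rank_gf_avoid := rank_gf [pred I : {set _} | ord_max \notin I].
Definition rank_gf_use := rank_gf [pred I : {set _} | ord_max \in I].

Lemma rank_gf_split : \sum_(I in indep M) ('X - 1) ^+ (rank M - #|I|) = rank_gf_avoid + rank_gf_use.
Proof. by rewrite (bigID (fun I : {set _} => ord_max \in I)) /= addrC. Qed.

Lemma indep_h_polyE : indep_h_poly M = rank_gf_avoid + rank_gf_use.
Proof.
rewrite -rank_gf_split /indep_h_poly.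
rewrite (partition_big (fun I : {set _} => inord #|I| : 'I_(rank M).+1) xpredT) //=.
apply: eq_bigr => i _; rewrite /nb_indep.
rewrite (eq_bigl (fun I => I \in [set I in indep M | #|I| == i])); last first.
  move=> I; rewrite [RHS]inE; case IM: (I \in indep M) => //=.
  by rewrite -val_eqE /= inordK // ltnS leq_card_rank.
rewrite (eq_bigr (fun=> ('X - 1) ^+ (rank M - i))); last by move=> I; rewrite inE => /andP[_ /eqP->].
by rewrite sumr_const scaler_nat.
Qed.

End RankGenerating.

Section RankGeneratingExt.
Variables (n : nat) (M : matroid 'I_n.+1).

Lemma rank_gf_avoid_parallel :
  rank_gf_avoid (parallel_ext M) = rank_gf_avoid M + rank_gf_use M.
Proof.
rewrite /rank_gf_avoid /rank_gf big_incl -rank_gf_split.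
apply: eq_big => [J|J _]; first exact: parallel_indep_incl.
by rewrite card_incl rank_parallel.
Qed.

Lemma rank_gf_use_parallel : rank_gf_use (parallel_ext M) = rank_gf_use M.
Proof.
rewrite /rank_gf_use /rank_gf big_max_incl -big_setU1.
apply: eq_big => [J|J]; first exact: parallel_indep_max.
rewrite parallel_indep_max => /andP[_ eJ].
by rewrite card_max_incl rank_parallel cardsU1 eJ.
Qed.

Hypothesis max_not_coloop : exists2 B, B \in bases M & ord_max \notin B.

Lemma rank_gf_use_series : rank_gf_use (series_ext M) = rank_gf_avoid M + rank_gf_use M.
Proof.
rewrite /rank_gf_use {1}/rank_gf big_max_incl -rank_gf_split.
apply: eq_big => [J|J _]; first exact: series_indep_max.
by rewrite card_max_incl rank_series // subSS.
Qed.

(** The sets that contain, respectively avoid, the old last element account for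
the two summands of ['X = 1 + ('X - 1)]. *)
Lemma rank_gf_avoid_series : rank_gf_avoid (series_ext M) = 'X * rank_gf_avoid M.
Proof.
rewrite /rank_gf_avoid {1}/rank_gf big_incl (bigID (fun J : {set _} => ord_max \in J)) /=.
set g := rank_gf _ _; have -> : 'X * g = g + ('X - 1) * g by ring.
rewrite /g /rank_gf; congr (_ + _).
  rewrite -big_setU1; apply: eq_big => [J|J].
    rewrite series_indep_incl //=; case eJ: (ord_max \in J); rewrite ?andbF //.
    by rewrite setU1K ?eJ.
  case/andP=> _ eJ; rewrite card_incl cardsU1 eJ rank_series // subSS.
rewrite mulr_sumr; apply: eq_big => [J|J].
  rewrite series_indep_incl //=; case eJ: (ord_max \in J); rewrite ?andbF //.
  by rewrite setD1_notin ?eJ.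
case/andP=> JM eJ; rewrite card_incl rank_series // -exprS subSn //.
apply: leq_card_rank; move: JM; rewrite series_indep_incl //.
by rewrite setD1_notin.
Qed.

End RankGeneratingExt.

(** * The h-vector of the independence complex of a snake *)

Lemma coloop_neq0 : [set [set: 'I_1]] != set0.
Proof. by apply/set0Pn; exists setT; rewrite inE. Qed.

Lemma coloop_exchange (B1 B2 : {set 'I_1}) :
  B1 \in [set [set: 'I_1]] -> B2 \in [set [set: 'I_1]] -> forall x, x \in B1 :\: B2 ->
  exists2 y, y \in B2 :\: B1 & y |: (B1 :\ x) \in [set [set: 'I_1]].
Proof. by move=> _ /set1P-> x; rewrite !inE. Qed.

(** [U12] is the parallel extension of a coloop. Starting there makes the initial
polytope a point, and the first segment a wedge like all later ones. *)
Definition coloop : matroid 'I_1 := Matroid coloop_neq0 coloop_exchange.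

Lemma set_ord1 (J : {set 'I_1}) : J = if ord0 \in J then setT else set0.
Proof. by apply/setP=> i; rewrite (ord1 i); case: ifP; rewrite !inE. Qed.

Lemma max_ord1 : ord_max = ord0 :> 'I_1.
Proof. exact: ord1. Qed.

Lemma U12_parallel : bases U12 = bases (parallel_ext coloop).
Proof.
have setT1 : [set: 'I_1] :\ ord_max = set0.
  by apply/setP=> i; rewrite !inE (ord1 i) max_ord1 eqxx.
apply/setP=> B; rewrite [RHS]inE inE; apply/idP/orP; last first.
  case=> /imsetP[J].
    by move=> /set1P-> ->; rewrite card_incl cardsT card_ord.
  by rewrite inE => /andP[/set1P-> _] ->; rewrite card_max_incl setT1 cards0.
have [eB|eB] := boolP (ord_max \in B).
  rewrite -(max_incl_restr eB) card_max_incl eqSS cards_eq0 => /eqP->; right.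
  by apply/imsetP; exists setT; rewrite ?setT1 // !inE eqxx.
rewrite -(incl_restr eB) card_incl => B1; left; apply/imsetP; exists setT; first by rewrite inE.
by move: B1; rewrite [restr B]set_ord1; case: ifP; rewrite ?cards0.
Qed.

Lemma eq_bases_indep (T : finType) (M N : matroid T) : bases M = bases N -> indep M = indep N.
Proof. by move=> E; rewrite /indep E. Qed.

Lemma eq_bases_rank (T : finType) (M N : matroid T) : bases M = bases N -> rank M = rank N.
Proof. by move=> E; rewrite /rank E. Qed.

Lemma eq_bases_rank_gf n (M N : matroid 'I_n.+1) P :
  bases M = bases N -> rank_gf M P = rank_gf N P.
Proof. by move=> E; rewrite /rank_gf (eq_bases_indep E) (eq_bases_rank E). Qed.

Lemma rank_coloop : rank coloop = 1.
Proof. by rewrite /rank big_set1 cardsT card_ord. Qed.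

Lemma coloop_indep J : J \in indep coloop.
Proof. by apply/indepP; exists setT; rewrite ?inE ?subsetT. Qed.

Lemma rank_gf_avoid_coloop : rank_gf_avoid coloop = 'X - 1.
Proof.
rewrite /rank_gf_avoid /rank_gf (big_pred1 set0) ?cards0 ?rank_coloop ?expr1 // => J.
by rewrite coloop_indep /= max_ord1 [J]set_ord1; case: ifP; rewrite !inE ?eqxx // => _; 
   apply/esym/negbTE/set0Pn; exists ord0.
Qed.

Lemma rank_gf_use_coloop : rank_gf_use coloop = 1.
Proof.
rewrite /rank_gf_use /rank_gf (big_pred1 setT) ?cardsT ?card_ord ?rank_coloop ?expr0 // => J.
rewrite coloop_indep /= max_ord1 [J]set_ord1; case: ifP; rewrite !inE ?eqxx // => _.
by apply/esym/negbTE; rewrite eq_sym; apply/set0Pn; exists ord0.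
Qed.

(** The new element of a parallel extension lies in no basis coming from the old
matroid; in a series extension it may be replaced in any basis avoiding the old
last element. *)
Lemma snake_max_not_coloop s k :
  exists2 B, B \in bases (snake_prefix s k) & ord_max \notin B.
Proof.
elim: k => [|k [B BM eB]] /=; first by exists [set ord0]; rewrite !inE ?cards1.
case: (nth _ _ _).
  exists (incl (ord_max |: B)); last by rewrite max_incl.
  by rewrite inE; apply/orP; right; apply/imsetP; exists B; rewrite ?inE ?BM.
by exists (incl B); rewrite ?max_incl // inE imset_f.
Qed.

(** [q] is ['X ^+ r * p(1 / 'X)]: the h-vector of the independence complex is read
from the coefficient of index [r] downwards. The size bounds make the relation
pass from [r] to [r + 1], when a new coefficient enters that must vanish. *)
Definition reverse_at (r : nat) (p q : {poly int}) :=
  [/\ forall i, (i <= r)%N -> p`_(r - i) = q`_i, (size p <= r.+1)%N & (size q <= r.+1)%N].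

Lemma reverse_atD r p1 p2 q1 q2 :
  reverse_at r p1 q1 -> reverse_at r p2 q2 -> reverse_at r (p1 + p2) (q1 + q2).
Proof.
move=> [E1 sp1 sq1] [E2 sp2 sq2]; split=> [i ir||]; first by rewrite !coefD E1 ?E2.
  by rewrite (leq_trans (size_polyD _ _)) // geq_max sp1.
by rewrite (leq_trans (size_polyD _ _)) // geq_max sq1.
Qed.

Lemma size_XM_leq (p : {poly int}) r : (size p <= r)%N -> (size ('X * p)%R <= r.+1)%N.
Proof. by move=> sp; rewrite (leq_trans (size_polyMleq _ _)) // size_polyX. Qed.

Lemma reverse_atC r p q : reverse_at r p q -> reverse_at r q p.
Proof. by case=> E sp sq; split=> // i ir; rewrite -E ?leq_subr ?subKn. Qed.

Lemma reverse_at_XMl r p q : reverse_at r p q -> reverse_at r.+1 ('X * p) q.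
Proof.
case=> E sp sq; split; [|exact: size_XM_leq|exact: leq_trans sq _] => i.
rewrite leq_eqVlt coefXM => /orP[/eqP->|]; first by rewrite subnn /= nth_default.
by rewrite ltnS => ir; rewrite subSn //= E.
Qed.

Lemma reverse_at_XMr r p q : reverse_at r p q -> reverse_at r.+1 p ('X * q).
Proof. by move/reverse_atC/reverse_at_XMl/reverse_atC. Qed.

Lemma snake_rank_gf s k (M := snake_prefix s k) :
  reverse_at (rank M) (rank_gf_avoid M) (indep_polys s k).1 /\
  reverse_at (rank M) (rank_gf_use M) ('X * (indep_polys s k).2).
Proof.
rewrite {}/M; elim: k => [|k].
  rewrite /= (eq_bases_rank U12_parallel) rank_parallel rank_coloop.
  rewrite /rank_gf_avoid /rank_gf_use !(eq_bases_rank_gf _ U12_parallel).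
  rewrite -/(rank_gf_avoid _) -/(rank_gf_use _) rank_gf_avoid_parallel rank_gf_use_parallel.
  rewrite rank_gf_avoid_coloop rank_gf_use_coloop subrK mulr1.
  have X1 : reverse_at 1 'X 1.
    rewrite -['X]mulr1; apply: reverse_at_XMl; split; rewrite ?size_poly1 //.
    by move=> i; rewrite leqn0 => /eqP->.
  by split=> //; apply: reverse_atC.
have ncl := snake_max_not_coloop s k.
rewrite /=; case: (indep_polys s k) => p a /= [Rp Ra].
have Rpa := reverse_atD Rp Ra.
case: (nth _ _ _) => /=.
  rewrite rank_series // rank_gf_avoid_series // rank_gf_use_series //.
  by split; [apply: reverse_at_XMl | apply: reverse_at_XMr].
by rewrite rank_parallel rank_gf_avoid_parallel rank_gf_use_parallel.
Qed.

Lemma indep_h_snake s k i : indep_h (snake_prefix s k) i = (indep_poly s k)`_i.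
Proof.
have [Rp Ra] := snake_rank_gf s k; have [E _ sq] := reverse_atD Rp Ra.
rewrite /indep_h indep_h_polyE; case: leqP => ir; first exact: E.
by rewrite nth_default // (leq_trans sq).
Qed.

(** * Affine functionals, faces and affine hulls *)

(* Imported only here, as these files shadow the notations of finite sets. *)
From mathcomp Require Import finmap boolp classical_sets cardinality.
Local Open Scope classical_set_scope.

Section AffineFunctionals.
Variables (R : realType) (n : nat).
Implicit Types (c x y : 'rV[R]_n) (P F A : set 'rV[R]_n).

Definition dot c x : R := \sum_i c ord0 i * x ord0 i.

Lemma dotDr c x y : dot c (x + y) = dot c x + dot c y.
Proof. by rewrite /dot -big_split /=; apply: eq_bigr => i _; rewrite !mxE mulrDr. Qed.

Lemma dotZr c a x : dot c (a *: x) = a * dot c x.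
Proof. by rewrite /dot mulr_sumr; apply: eq_bigr => i _; rewrite !mxE mulrCA. Qed.

Lemma dotC c x : dot c x = dot x c.
Proof. by apply: eq_bigr => i _; rewrite mulrC. Qed.

Lemma dotDl c x y : dot (x + y) c = dot x c + dot y c.
Proof. by rewrite dotC dotDr !(dotC c). Qed.

Lemma dotZl c a x : dot (a *: x) c = a * dot x c.
Proof. by rewrite dotC dotZr (dotC c). Qed.

Lemma dot_delta c i : dot c (delta_mx ord0 i) = c ord0 i.
Proof.
rewrite /dot (bigD1 i) //= mxE !eqxx mulr1 big1 ?addr0 // => j ji.
by rewrite mxE eqxx (negbTE ji) mulr0.
Qed.

(** Faces are cut out by the zeros of affine functionals that are nonpositive on the
polytope; working with these, rather than with coefficient vectors, lets them be
pulled back to and extended from the segments of a wedge. *)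
Definition affine_fun (g : 'rV[R]_n -> R) := exists c b, forall x, g x = dot c x - b.

Lemma is_faceP P F : is_face P F <->
  exists2 g, affine_fun g & (forall x, P x -> g x <= 0) /\ F = P `&` [set x | g x = 0].
Proof.
split=> [[c [b [cb ->]]]|[g [c [b gE]] [g0 ->]]].
  exists (fun x => dot c x - b); first by exists c, b.
  split=> [x /cb|]; first by rewrite subr_le0.
  congr (_ `&` _); apply/seteqP; split=> x /=; first by move=> <-; rewrite subrr.
  by move/eqP; rewrite subr_eq0 => /eqP.
exists c, b; split=> [x /g0|]; first by rewrite gE subr_le0.
congr (_ `&` _); apply/seteqP; split=> x /=; rewrite gE; last by move=> <-; rewrite subrr.
by move/eqP; rewrite subr_eq0 => /eqP.
Qed.

Lemma affine_funD g1 g2 : affine_fun g1 -> affine_fun g2 -> affine_fun (fun x => g1 x + g2 x).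
Proof.
move=> [c1 [b1 E1]] [c2 [b2 E2]]; exists (c1 + c2), (b1 + b2) => x.
by rewrite E1 E2 dotDl; ring.
Qed.

Lemma affine_funZ a g : affine_fun g -> affine_fun (fun x => a * g x).
Proof. by move=> [c [b E]]; exists (a *: c), (a * b) => x; rewrite E dotZl; ring. Qed.

Lemma affine_fun_comb g m (w : 'I_m -> R) (p : 'I_m -> 'rV[R]_n) : affine_fun g ->
  \sum_i w i = 1 -> \sum_i w i * g (p i) = g (\sum_i w i *: p i).
Proof.
move=> [c [b E]] w1; rewrite E.
have -> : dot c (\sum_i w i *: p i) = \sum_i w i * dot c (p i).
  rewrite (big_morph (dot c) (@dotDr c) (id1 := 0)); last by rewrite -(scale0r 0) dotZr mul0r.
  by apply: eq_bigr => i _; rewrite dotZr.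
under eq_bigr do rewrite E mulrBr.
by rewrite sumrB -mulr_suml w1 mul1r.
Qed.

End AffineFunctionals.

Section AffineHull.
Variables (R : realType).

Lemma sub_affine_hull n (A : set 'rV[R]_n) : A `<=` affine_hull A.
Proof.
move=> x Ax; exists 1%N, (fun=> x), (fun=> 1); split=> //; first by rewrite big_ord1.
by rewrite big_ord1 scale1r.
Qed.

(** The two new points enter with the opposite weights [a] and [- a]. *)
Lemma affine_hull_shift n (A : set 'rV[R]_n) a x y z :
  affine_hull A x -> A y -> A z -> affine_hull A (x + a *: (y - z)).
Proof.
move=> [m [p [w [pA w1 ->]]]] Ay Az.
pose p' (i : 'I_(m + 2)) := match split i with inl j => p j | inr k => if k == 0 then y else z end.
pose w' (i : 'I_(m + 2)) := match split i with inl j => w j | inr k => if k == 0 then a else - a end.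
have splitl (i : 'I_m) : split (lshift 2 i) = inl i by exact: (unsplitK (inl i)).
have splitr (i : 'I_2) : split (rshift m i) = inr i by exact: (unsplitK (inr i)).
exists (m + 2)%N, p', w'; split.
- by move=> i; rewrite /p'; case: split => // k; case: ifP.
- rewrite big_split_ord /= 2!big_ord_recl big_ord0 /w' !splitr /=.
  by under eq_bigr do rewrite splitl; rewrite w1; ring.
- rewrite big_split_ord /= 2!big_ord_recl big_ord0 /w' /p' !splitr /= addr0.
  by under [in RHS]eq_bigr do rewrite splitl; rewrite scalerBr scaleNr.
Qed.

Lemma sum_affine_comb n m (M : 'M[R]_(n, m)) c k (w : 'I_k -> R) (p : 'I_k -> 'rV[R]_n) :
  \sum_i w i = 1 ->
  \sum_i w i *: (p i *m M + c) = (\sum_i w i *: p i) *m M + c.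
Proof.
move=> w1; under eq_bigr do rewrite scalerDr.
rewrite big_split /= -scaler_suml w1 scale1r mulmx_suml; congr (_ + _).
by apply: eq_bigr => i _; rewrite scalemxAl.
Qed.

Lemma affine_hull_image n m (M : 'M[R]_(n, m)) c (A : set 'rV[R]_n) :
  affine_hull [set x *m M + c | x in A] = [set x *m M + c | x in affine_hull A].
Proof.
apply/seteqP; split=> y /=.
  move=> [k [p [w [pA w1 ->]]]].
  have /choice[q qE] : forall i, exists x, A x /\ x *m M + c = p i by move=> i; have [x] := pA i; exists x.
  exists (\sum_i w i *: q i); first by exists k, q, w; split=> // i; have [] := qE i.
  by rewrite -sum_affine_comb //; apply: eq_bigr => i _; have [_ ->] := qE i.
move=> [x [k [p [w [pA w1 ->]]]] <-]; rewrite -sum_affine_comb //.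
by exists k, (fun i => p i *m M + c), w; split=> // i; exists (p i).
Qed.

Lemma has_dim_image n m (M : 'M[R]_(n, m)) c (A : set 'rV[R]_n) k :
  (forall x : 'rV_n, x *m M = 0 -> x = 0) -> has_dim A k ->
  has_dim [set x *m M + c | x in A] k.
Proof.
move=> Minj [x [U [dU AU]]].
exists (x *m M + c), (linfun (mulmxr M) @: U)%VS; split.
  rewrite limg_dim_eq //; apply/eqP; rewrite -subv0; apply/subvP => v.
  rewrite memv_cap memv_ker lfunE /= => /andP[_ /eqP/Minj->]; exact: mem0v.
rewrite affine_hull_image AU; apply/seteqP; split=> y /=.
  move=> [_ [u uU <-] <-]; exists (u *m M); last by rewrite mulmxDl addrAC.
  by apply/memv_imgP; exists u; rewrite ?lfunE.
move=> [_ /memv_imgP[u uU ->] <-]; rewrite lfunE /=; exists (x + u); first by exists u.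
by rewrite mulmxDl addrAC.
Qed.

(** A translate of a linear subspace determines the subspace as the set of
differences of its elements. *)
Lemma has_dim_unique n (A : set 'rV[R]_n) k l : has_dim A k -> has_dim A l -> k = l.
Proof.
move=> [x [U [<- AU]]] [y [V [<- AV]]].
have sub (x1 x2 : 'rV[R]_n) (U1 U2 : {vspace 'rV[R]_n}) :
    [set x1 + u | u in [set` U1]] `<=` [set x2 + u | u in [set` U2]] -> (U1 <= U2)%VS.
  move=> H; apply/subvP => u uU.
  have [|v /= vV Ev] := H (x1 + u); first by exists u.
  have [|v0 /= v0V Ev0] := H (x1 + 0); first by exists 0 => //=; apply: mem0v.
  have -> : u = v - v0.
    by apply: (addrI x1); rewrite -Ev -[x1]addr0 -Ev0 -addrA (addrC v0) subrK.
  exact: rpredB.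
have [UV VU] : (U <= V)%VS /\ (V <= U)%VS.
  by split; [apply: (sub x y) | apply: (sub y x)]; rewrite -AU -AV.
by apply/eqP; rewrite eqn_leq !dimvS.
Qed.

End AffineHull.

(** * Wedges and their faces *)

Section Wedge.
Variables (R : realType) (n : nat) (b : bool).
Implicit Types (x : 'rV[R]_n.+1) (t : R) (P F A V : set 'rV[R]_n.+1) (G : set 'rV[R]_n.+2).

Definition embed_mx : 'M[R]_(n.+1, n.+2) := \matrix_(i, j) (j == lift ord_max i)%:R.

(** The sign is chosen so that in both extensions the segment over [x] starts at
parameter 0 and runs through nonnegative parameters: a parallel extension moves
weight from the old last element to the new one, a series extension back. *)
Definition wedge_dir : 'rV[R]_n.+2 :=
  (-1) ^+ b *: (delta_mx ord0 ord_max - delta_mx ord0 (lift ord_max ord_max)).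

Definition wedge_pt x t : 'rV[R]_n.+2 :=
  x *m embed_mx + b%:R *: delta_mx ord0 ord_max + t *: wedge_dir.

Definition height x : R := if b then 1 - x ord0 ord_max else x ord0 ord_max.

Lemma heightE x : height x = if b then 1 - x ord0 ord_max else x ord0 ord_max.
Proof. by []. Qed.

Lemma wedge_ptE x t : wedge_pt x t =
  x *m embed_mx + b%:R *: delta_mx ord0 ord_max + t *: wedge_dir.
Proof. by []. Qed.

Definition bottom F := [set wedge_pt x 0 | x in F].
Definition top F := [set wedge_pt x (height x) | x in F].
Definition wedge F :=
  [set y | exists x t, [/\ F x, 0 <= t <= height x & y = wedge_pt x t]].

Lemma embed_lift x i : (x *m embed_mx) ord0 (lift ord_max i) = x ord0 i.
Proof.
rewrite mxE (bigD1 i) //= mxE eqxx mulr1 big1 ?addr0 // => j ji.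
by rewrite mxE (inj_eq (@lift_inj _ _)) eq_sym (negbTE ji) mulr0.
Qed.

Lemma embed_max x : (x *m embed_mx) ord0 ord_max = 0.
Proof. by rewrite mxE big1 // => j _; rewrite mxE max_neq_lift mulr0. Qed.

Lemma wedge_pt_max x t : wedge_pt x t ord0 ord_max = b%:R + (-1) ^+ b * t.
Proof.
rewrite /wedge_pt /wedge_dir mxE [X in X + _]mxE embed_max !mxE !eqxx max_neq_lift /= add0r mulr1 subr0 mulr1.
by rewrite (mulrC t).
Qed.

Lemma wedge_pt_inj x1 t1 x2 t2 : wedge_pt x1 t1 = wedge_pt x2 t2 -> x1 = x2 /\ t1 = t2.
Proof.
move=> E; have Et : t1 = t2.
  move/rowP: (E) => /(_ ord_max); rewrite !wedge_pt_max => /addrI.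
  by apply: mulfI; rewrite signr_eq0.
split=> //; move: E; rewrite /wedge_pt Et => /addIr/addIr Ex.
by apply/rowP=> i; rewrite -!embed_lift Ex.
Qed.

Lemma wedge_pt_comb m (w : 'I_m -> R) (x : 'I_m -> 'rV[R]_n.+1) (t : 'I_m -> R) :
  \sum_i w i = 1 ->
  \sum_i w i *: wedge_pt (x i) (t i) = wedge_pt (\sum_i w i *: x i) (\sum_i w i * t i).
Proof.
move=> w1; rewrite /wedge_pt -sum_affine_comb // scaler_suml -big_split /=.
by apply: eq_bigr => i _; rewrite scalerDr scalerA.
Qed.

Lemma height_affine : affine_fun height.
Proof.
exists ((-1) ^+ b *: delta_mx ord0 ord_max), (- b%:R) => x.
by rewrite dotZl dotC dot_delta /height; case: b; rewrite /= ?expr1 ?expr0; ring.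
Qed.

(** The slope [a] in the direction of the segments does not depend on [x]. *)
Lemma affine_fun_wedge_pt (g : 'rV[R]_n.+2 -> R) : affine_fun g ->
  exists2 g0, affine_fun g0 & exists a, forall x t, g (wedge_pt x t) = g0 x + a * t.
Proof.
move=> [c [d gE]].
exists (fun x => dot (\row_i c ord0 (lift ord_max i)) x - (d - b%:R * c ord0 ord_max)).
  by exists (\row_i c ord0 (lift ord_max i)), (d - b%:R * c ord0 ord_max).
exists (dot c wedge_dir) => x t.
rewrite gE /wedge_pt !dotDr !dotZr dot_delta.
have -> : dot c (x *m embed_mx) = dot (\row_i c ord0 (lift ord_max i)) x.
  rewrite /dot [LHS](bigD1_ord ord_max) //= embed_max mulr0 add0r.
  by apply: eq_bigr => i _; rewrite embed_lift mxE.
by move: b%:R => s; ring.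
Qed.

(** The embedding of pairs [(x, t)] is an affine isomorphism onto its image, so every
affine function of [(x, t)] extends to the ambient space. *)
Lemma affine_fun_extend g a : affine_fun g ->
  exists2 h, affine_fun h & forall x t, h (wedge_pt x t) = g x + a * t.
Proof.
move=> [c [d gE]].
pose c' : 'rV[R]_n.+2 :=
  c *m embed_mx + (c ord0 ord_max + (-1) ^+ b * a) *: delta_mx ord0 ord_max.
exists (fun y => dot c' y - (d + b%:R * c' ord0 ord_max)).
  by exists c', (d + b%:R * c' ord0 ord_max).
have c'l i : c' ord0 (lift ord_max i) = c ord0 i.
  by rewrite mxE embed_lift !mxE lift_neq_max mulr0 addr0.
have c'm : c' ord0 ord_max = c ord0 ord_max + (-1) ^+ b * a.
  by rewrite mxE embed_max !mxE !eqxx mulr1 add0r.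
move=> x t; rewrite gE /wedge_pt !dotDr !dotZr.
have -> : dot c' (x *m embed_mx) = dot c x.
  rewrite /dot [LHS](bigD1_ord ord_max) //= embed_max mulr0 add0r.
  by apply: eq_bigr => i _; rewrite embed_lift c'l.
rewrite -scaleN1r dotDr dotZr !dot_delta c'l c'm.
by rewrite mulN1r [_ + _ * a]addrC addrK signrMK; move: b%:R => s; ring.
Qed.

(** The sign of the slope [a] of a functional along the segments decides the shape
of its face. For [a < 0] only the bottoms [t = 0] can be extremal, for [a > 0] only
the tops, where the functional becomes [h + a * height] on the base, and for [a = 0]
whole segments are. Conversely, every face of the base arises in the three ways,
by giving a functional on the base slope -1, 1 or 0. *)
Lemma is_face_wedge P G : (forall x, P x -> 0 <= height x) ->
  is_face (wedge P) G <->
  exists2 F, is_face P F & [\/ G = top F, G = bottom F | G = wedge F].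
Proof.
move=> zP.
have wP x t : P x -> 0 <= t <= height x -> wedge P (wedge_pt x t) by move=> Px tz; exists x, t.
have z0 x : P x -> 0 <= (0 : R) <= height x by move=> Px; rewrite lexx zP.
have zz x : P x -> 0 <= height x <= height x by move=> Px; rewrite lexx zP.
split=> [/is_faceP[g gA [g0 ->]]|[F /is_faceP[g gA [g0 ->]]]].
  have [h hA [a gE]] := affine_fun_wedge_pt gA.
  have hP x t : P x -> 0 <= t <= height x -> h x + a * t <= 0.
    by move=> Px tz; rewrite -gE; apply/g0/wP.
  have hP0 x : P x -> h x <= 0 by move=> Px; have := hP x 0 Px (z0 x Px); rewrite mulr0 addr0.
  have [a0|a0|a0] := ltgtP a 0.
  - exists (P `&` [set x | h x = 0]); first by apply/is_faceP; exists h.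
    constructor 2; apply/seteqP; split=> y /=.
      move=> [[x [t [Px /andP[t0 tz] ->]]]]; rewrite gE => E.
      have hx := hP0 x Px; have at0 : a * t = 0 by nra.
      exists x; first by split=> //=; rewrite -E at0 addr0.
      by move/eqP: at0; rewrite mulf_eq0 lt_eqF //= => /eqP->.
    move=> [x [Px hx] <-]; split; first by apply: wP => //; apply: z0.
    by rewrite /= gE hx mulr0 addr0.
  - exists (P `&` [set x | h x + a * height x = 0]).
      apply/is_faceP; exists (fun x => h x + a * height x); last by split=> // x Px; exact/hP/zz.
      by apply: affine_funD => //; apply/affine_funZ/height_affine.
    constructor 1; apply/seteqP; split=> y /=.
      move=> [[x [t [Px /andP[t0 tz] ->]]]]; rewrite gE => E.
      have hx := hP x _ Px (zz x Px); have : a * (height x - t) = 0 by nra.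
      move/eqP; rewrite mulf_eq0 gt_eqF //= subr_eq0 => /eqP Et.
      by exists x; [split; rewrite //= Et | rewrite Et].
    move=> [x [Px hx] <-]; split; first by apply: wP => //; apply: zz.
    by rewrite /= gE.
  - exists (P `&` [set x | h x = 0]); first by apply/is_faceP; exists h.
    constructor 3; apply/seteqP; split=> y /=.
      move=> [[x [t [Px tz ->]]]]; rewrite gE a0 mul0r addr0 => E.
      by exists x, t.
    by move=> [x [t [[Px hx] tz ->]]]; split; [exact: wP | rewrite /= gE hx a0 mul0r addr0].
case=> ->; apply/is_faceP.
- have [h hA hE] := affine_fun_extend 1 (affine_funD gA (affine_funZ (-1) height_affine)).
  exists h => //; split=> [_ [x [t [Px /andP[t0 tz] ->]]]|].
    by rewrite hE; have := g0 x Px; lra.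
  apply/seteqP; split=> y /=.
    by move=> [x [Px /= gx] <-]; split; [exact/wP/zz | rewrite /= hE gx; ring].
  move=> [[x [t [Px /andP[t0 tz] ->]]]]; rewrite hE => E; have gx := g0 x Px.
  have tE : t = height x by lra.
  by exists x; [split=> //=; lra | rewrite tE].
- have [h hA hE] := affine_fun_extend (-1) gA.
  exists h => //; split=> [_ [x [t [Px /andP[t0 tz] ->]]]|].
    by rewrite hE; have := g0 x Px; lra.
  apply/seteqP; split=> y /=.
    by move=> [x [Px /= gx] <-]; split; [exact/wP/z0 | rewrite /= hE gx; ring].
  move=> [[x [t [Px /andP[t0 tz] ->]]]]; rewrite hE => E; have gx := g0 x Px.
  have tE : t = 0 by lra.
  by exists x; [split=> //=; lra | rewrite tE].
- have [h hA hE] := affine_fun_extend 0 gA.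
  exists h => //; split=> [_ [x [t [Px tz ->]]]|].
    by rewrite hE mul0r addr0; apply: g0.
  apply/seteqP; split=> y /=.
    by move=> [x [t [[Px /= gx] tz ->]]]; split; [exact/wP | rewrite /= hE gx; ring].
  move=> [[x [t [Px tz ->]]]]; rewrite hE mul0r addr0 => E.
  by exists x, t.
Qed.

End Wedge.

(** * Dimensions of the faces of a wedge *)

Section WedgeDim.
Variables (R : realType) (n : nat) (b : bool).
Local Notation wedge_pt := (@wedge_pt R n b).
Local Notation height := (@height R n b).
Local Notation bottom := (@bottom R n b).
Local Notation top := (@top R n b).
Local Notation wedge := (@wedge R n b).
Local Notation wedge_dir := (wedge_dir R n b).
Local Notation embed_mx := (embed_mx R n).
Implicit Types (x : 'rV[R]_n.+1) (t : R) (P F A V : set 'rV[R]_n.+1) (G : set 'rV[R]_n.+2).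

Lemma embed_mx_inj x : x *m embed_mx = 0 -> x = 0.
Proof. by move=> /rowP E; apply/rowP=> i; rewrite -embed_lift E !mxE. Qed.

Lemma wedge_pt0 x : wedge_pt x 0 = x *m embed_mx + b%:R *: delta_mx ord0 ord_max.
Proof. by rewrite /wedge_pt scale0r addr0. Qed.

Lemma has_dim_bottom F k : has_dim F k -> has_dim (bottom F) k.
Proof.
rewrite /bottom; under eq_imagel do rewrite wedge_pt0.
exact/has_dim_image/embed_mx_inj.
Qed.

(** [x |-> wedge_pt x (height x)] is again an injective affine map: its linear part
is the embedding plus a rank one map, and the coordinate of the new element
recovers the last coordinate of [x] up to sign. *)
Lemma has_dim_top F k : has_dim F k -> has_dim (top F) k.
Proof.
pose N : 'M[R]_(n.+1, n.+2) := (-1) ^+ b *: (delta_mx ord_max ord0 *m wedge_dir).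
have NE x : x *m N = ((-1) ^+ b * x ord0 ord_max) *: wedge_dir.
  by rewrite -scalemxAr mulmxA -colE [col _ _]mx11_scalar mul_scalar_mx mxE scalerA.
have topE x : wedge_pt x (height x) =
    x *m (embed_mx + N) + (b%:R *: delta_mx ord0 ord_max + b%:R *: wedge_dir).
  rewrite /wedge_pt mulmxDr NE addrACA -scalerDl; congr (_ + _ *: _).
  rewrite /height; case: b; rewrite /= ?expr1 ?expr0; ring.
rewrite /top; under eq_imagel do rewrite topE.
apply: has_dim_image => x; rewrite mulmxDr NE => E.
have xm : x ord0 ord_max = 0.
  move/rowP: (E) => /(_ ord_max); rewrite mxE embed_max !mxE !eqxx max_neq_lift /=.
  by rewrite add0r subr0 mulr1 mulrAC -expr2 sqrr_sign mul1r.
by move: E; rewrite xm mulr0 scale0r addr0 => /embed_mx_inj.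
Qed.

Lemma wedge_dir_neq0 : wedge_dir != 0.
Proof.
apply/eqP => /rowP/(_ ord_max); rewrite !mxE !eqxx max_neq_lift /= subr0 mulr1.
by apply/eqP; rewrite signr_eq0.
Qed.

(** A segment of nonzero length over one point adds the direction [wedge_dir], which
is not in the linear image of the base since the new coordinate vanishes there. *)
Lemma has_dim_wedge F k x1 : (forall x, F x -> 0 <= height x) -> F x1 -> height x1 != 0 ->
  has_dim F k -> has_dim (wedge F) k.+1.
Proof.
move=> zF Fx1 z1 [x [U [dU AU]]].
have embE (u : 'rV[R]_n.+1) : linfun (mulmxr embed_mx) u = u *m embed_mx by rewrite lfunE.
exists (wedge_pt x 0), (linfun (mulmxr embed_mx) @: U + <[wedge_dir]>)%VS; split.
  rewrite dimv_disjoint_sum.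
    rewrite dim_vline wedge_dir_neq0 addn1 limg_dim_eq ?dU //.
    apply/eqP; rewrite -subv0; apply/subvP => v.
    by rewrite memv_cap memv_ker embE => /andP[_ /eqP/embed_mx_inj->]; rewrite mem0v.
  apply/eqP; rewrite -subv0; apply/subvP => v; rewrite memv_cap.
  case/andP=> /memv_imgP[u _ ->] /vlineP[a]; rewrite embE => E.
  move/rowP: (E) => /(_ ord_max); rewrite embed_max !mxE !eqxx max_neq_lift /= subr0 mulr1.
  move/esym/eqP; rewrite mulf_eq0 signr_eq0 orbF => /eqP a0.
  by rewrite E a0 scale0r mem0v.
have wP y t : F y -> 0 <= t <= height y -> wedge F (wedge_pt y t) by move=> Fy tz; exists y, t.
have dirE y t : wedge_pt y t = wedge_pt y 0 + t *: wedge_dir by rewrite wedge_pt0.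
apply/seteqP; split=> y /=.
  move=> [m [p [w [pA w1 ->]]]].
  have /choice[q qE] : forall i, exists xt, F xt.1 /\ p i = wedge_pt xt.1 xt.2.
    by move=> i; have [z [t [Fz _ ->]]] := pA i; exists (z, t).
  have : affine_hull F (\sum_i w i *: (q i).1).
    by exists m, (fun i => (q i).1), w; split=> // i; have [] := qE i.
  rewrite AU => -[u /= uU uE].
  exists (u *m embed_mx + (\sum_i w i * (q i).2) *: wedge_dir).
    rewrite /= memv_add //; last by rewrite memvZ // memv_line.
    by rewrite -embE memv_img.
  under eq_bigr => i _ do rewrite (proj2 (qE i)).
  rewrite wedge_pt_comb // -uE [RHS]dirE !wedge_pt0 mulmxDl.
  by rewrite !addrA; congr (_ + _); rewrite addrAC.
move=> [_ /memv_addP[_ /memv_imgP[u uU ->] [_ /vlineP[a ->] ->]] <-]; rewrite embE.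
have : affine_hull F (x + u) by rewrite AU; exists u.
move=> [m [p [w [pA w1 xuE]]]].
have -> : wedge_pt x 0 + (u *m embed_mx + a *: wedge_dir) =
    wedge_pt (x + u) 0 + (a / height x1) *: (wedge_pt x1 (height x1) - wedge_pt x1 0).
  rewrite [wedge_pt x1 (height _)]dirE (addrC (wedge_pt x1 0)) addrK [X in _ = _ + X]scalerA divfK //.
  by rewrite !wedge_pt0 mulmxDl !addrA; congr (_ + _); rewrite addrAC.
apply: affine_hull_shift; [|apply: wP => //|apply: wP => //]; rewrite ?lexx ?zF //.
rewrite xuE; have -> : 0 = \sum_i w i * 0 :> R by under eq_bigr do rewrite mulr0; rewrite big1.
rewrite -wedge_pt_comb //; exists m, (fun i => wedge_pt (p i) 0), w; split=> // i.
by apply: wP; rewrite // lexx zF.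
Qed.

(** Projection along the segments. It returns the face from which any of the three
kinds of faces was made, so that different faces yield different copies. *)
Definition shadow G := [set x | exists t, G (wedge_pt x t)].

Lemma shadow_bottom F : shadow (bottom F) = F.
Proof.
apply/seteqP; split=> x; last by move=> Fx; exists 0, x.
by move=> [t [y Fy /wedge_pt_inj[<-]]].
Qed.

Lemma shadow_top F : shadow (top F) = F.
Proof.
apply/seteqP; split=> x; last by move=> Fx; exists (height x), x.
by move=> [t [y Fy /wedge_pt_inj[<-]]].
Qed.

Lemma shadow_wedge F : (forall x, F x -> 0 <= height x) -> shadow (wedge F) = F.
Proof.
move=> zF; apply/seteqP; split=> x; last by move=> Fx; exists 0, x, 0; rewrite lexx zF.
by move=> [t [y [t' [Fy _ /wedge_pt_inj[-> _]]]]].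
Qed.

End WedgeDim.

(** * Enumerating the faces of a wedge *)

Section FaceLists.
Variable R : realType.

(** A duplicate-free enumeration of the nonempty faces with their dimensions, which
at once proves their number finite and permits sums over them. *)
Definition face_list n (P : set 'rV[R]_n) (d : nat) (fs : seq (set 'rV[R]_n * nat)) :=
  [/\ uniq (map fst fs),
      forall F, F \in map fst fs <-> is_face P F /\ F !=set0,
      forall Fk, Fk \in fs -> has_dim Fk.1 Fk.2 &
      forall Fk, Fk \in fs -> (Fk.2 <= d)%N].

Definition face_gf n (fs : seq (set 'rV[R]_n * nat)) (p : pred (set 'rV[R]_n)) : {poly int} :=
  \sum_(Fk <- fs | p Fk.1) ('X - 1) ^+ Fk.2.

(** Only nonempty sets have a dimension, and only one, so the faces of dimension [i]
are those listed with [i]. *)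
Lemma nb_facesE n (P : set 'rV[R]_n) d fs i : face_list P d fs ->
  nb_faces P i = count (fun Fk => Fk.2 == i) fs.
Proof.
move=> [fs_uniq fsE fs_dim _]; rewrite /nb_faces.
pose s := map fst (filter (fun Fk => Fk.2 == i) fs).
have -> : [set F | is_face P F /\ has_dim F i] = [set` [fset F in s]%fset].
  apply/seteqP; split=> F /=; rewrite inE /=.
    move=> [PF Fi]; have F0 : F !=set0.
      apply: contrapT => /set0P/negP; rewrite negbK => /eqP F0.
      move: Fi => [x [U [_ /seteqP[_ /(_ x)]]]]; rewrite F0 => H.
      have [|m [p [w [pA w1 _]]]] := H; first by exists 0; rewrite ?addr0 //=; apply: mem0v.
      by case: m p w pA w1 => [|m] p w pA; [rewrite big_ord0 => /esym/eqP; rewrite oner_eq0 | have := pA ord0].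
    have /mapP[[F' k] Fk /= FF'] := (fsE F).2 (conj PF F0).
    apply/mapP; exists (F', k) => //; rewrite mem_filter Fk andbT /=; apply/eqP.
    by apply: (@has_dim_unique _ _ F) => //; rewrite FF'; have := fs_dim _ Fk.
  move=> /mapP[Fk]; rewrite mem_filter => /andP[/eqP <- Fkfs] ->.
  split; last exact: fs_dim.
  by have [] := (fsE Fk.1).1 (map_f _ Fkfs).
rewrite set_fsetK card_fseq undup_id ?size_map ?size_filter //.
by apply: subseq_uniq fs_uniq; apply/map_subseq/filter_subseq.
Qed.

Lemma polytope_h_polyE n (P : set 'rV[R]_n) d fs : face_list P d fs ->
  polytope_h_poly P d = face_gf fs xpredT.
Proof.
move=> fsP; have [_ _ _] := fsP; rewrite /polytope_h_poly /face_gf.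
under eq_bigr do rewrite (nb_facesE _ fsP).
elim: fs {fsP} => [|Fk fs IH] fs_d; first by rewrite big_nil big1 // => i _; rewrite scale0r.
rewrite big_cons -IH => [|F'k Ffs]; last by apply: fs_d; rewrite inE Ffs orbT.
have kd : (Fk.2 < d.+1)%N by apply: fs_d; rewrite inE eqxx.
under eq_bigr do rewrite /= natrD scalerDl.
rewrite big_split /= (bigD1 (Ordinal kd)) //= eqxx scale1r big1 ?addr0 // => i ik.
by rewrite -val_eqE eq_sym in ik; rewrite (negbTE ik) scale0r.
Qed.

Definition max_const n v (F : set 'rV[R]_n.+1) := `[< forall x, F x -> x ord0 ord_max = v >].

End FaceLists.

Section WedgeFaces.
Variables (R : realType) (n : nat) (b : bool).
Local Notation wedge_pt := (@wedge_pt R n b).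
Local Notation height := (@height R n b).
Local Notation bottom := (@bottom R n b).
Local Notation top := (@top R n b).
Local Notation wedge := (@wedge R n b).
Implicit Types (x : 'rV[R]_n.+1) (t : R) (P F A V : set 'rV[R]_n.+1) (G : set 'rV[R]_n.+2).

Lemma height_eq0 x : (height x == 0) = (x ord0 ord_max == b%:R).
Proof. by rewrite heightE; case: b; rewrite //= subr_eq0 eq_sym. Qed.

Local Notation flat := (max_const (b%:R : R)).

Lemma flatP F : reflect (forall x, F x -> height x = 0) (flat F).
Proof.
by apply: (iffP (asboolP _)) => H x /H /eqP; [rewrite -height_eq0 => /eqP | rewrite height_eq0 => /eqP].
Qed.

Lemma nonflatP F : ~~ flat F -> exists2 x, F x & height x != 0.
Proof.
move=> /flatP fF; apply: contrapT => H; apply: fF => x Fx.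
by apply/eqP; apply: contrapT => /negP xz; apply: H; exists x.
Qed.

Lemma wedge_pt_max_b x t : (wedge_pt x t ord0 ord_max = b%:R) <-> (t = 0).
Proof.
rewrite wedge_pt_max; split=> [E|->]; last by rewrite mulr0 addr0.
apply: (@mulfI _ ((-1) ^+ b)); first by rewrite signr_eq0.
by apply: (addrI b%:R); rewrite E mulr0 addr0.
Qed.

Lemma wedge_pt_max_nb x t : (wedge_pt x t ord0 ord_max = (~~ b)%:R) <-> (t = 1).
Proof. by rewrite wedge_pt_max; case: b; rewrite /= ?expr1 ?expr0; split=> H; lra. Qed.

Lemma max_nb_height x : (x ord0 ord_max = (~~ b)%:R) <-> (height x = 1).
Proof. by rewrite heightE; case: b; split=> /= H; lra. Qed.

Lemma max_const_bottom F : max_const b%:R (bottom F).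
Proof. by apply/asboolP => _ [x _ <-]; apply/wedge_pt_max_b. Qed.

Lemma max_const_bottom_nb F : F !=set0 -> max_const (~~ b)%:R (bottom F) = false.
Proof.
move=> [x Fx]; apply/asboolP => /(_ (wedge_pt x 0)) H.
by have /wedge_pt_max_nb/eqP := H (ex_intro2 _ _ _ Fx erefl); rewrite eq_sym oner_eq0.
Qed.

Lemma max_const_top F : max_const b%:R (top F) = max_const b%:R F.
Proof.
apply/asboolP/flatP => H; first by move=> x Fx; apply/wedge_pt_max_b/H; exists x.
by move=> _ [x Fx <-]; apply/wedge_pt_max_b/H.
Qed.

Lemma max_const_top_nb F : max_const (~~ b)%:R (top F) = max_const (~~ b)%:R F.
Proof.
apply/asboolP/asboolP => H.
  by move=> x Fx; apply/max_nb_height/(@wedge_pt_max_nb x)/H; exists x.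
by move=> _ [x Fx <-]; apply/wedge_pt_max_nb/max_nb_height/H.
Qed.

Lemma wedge_bottom F x : (forall x, F x -> 0 <= height x) -> F x -> wedge F (wedge_pt x 0).
Proof. by move=> zF Fx; exists x, 0; rewrite lexx zF. Qed.

Lemma wedge_top F x : (forall x, F x -> 0 <= height x) -> F x -> wedge F (wedge_pt x (height x)).
Proof. by move=> zF Fx; exists x, (height x); rewrite lexx zF. Qed.

Lemma max_const_wedge F : (forall x, F x -> 0 <= height x) -> ~~ flat F ->
  max_const b%:R (wedge F) = false.
Proof.
move=> zF /nonflatP[x Fx /eqP xz]; apply/asboolP => H; apply: xz.
by apply/(@wedge_pt_max_b x)/H/wedge_top.
Qed.

Lemma max_const_wedge_nb F : (forall x, F x -> 0 <= height x) -> F !=set0 ->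
  max_const (~~ b)%:R (wedge F) = false.
Proof.
move=> zF [x Fx]; apply/asboolP => H.
by have /wedge_pt_max_nb/eqP := H _ (wedge_bottom zF Fx); rewrite eq_sym oner_eq0.
Qed.

Lemma flat_top F : flat F -> top F = bottom F.
Proof.
by move=> /flatP H; apply/seteqP; split=> _ [x Fx <-]; exists x => //; rewrite H.
Qed.

Lemma flat_wedge F : (forall x, F x -> 0 <= height x) -> flat F -> wedge F = bottom F.
Proof.
move=> zF /flatP H; apply/seteqP; split=> [_ [x [t [Fx tz ->]]]|_ [x Fx <-]].
  by exists x => //; congr (wedge_pt x _); move: tz; rewrite (H x) //; lra.
exact: wedge_bottom.
Qed.

Lemma nonflat_top_bottom F F' : ~~ flat F -> top F' <> bottom F.
Proof.
move=> /nonflatP[x Fx xz] E.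
have F'F : F' = F by rewrite -(shadow_top b F') E shadow_bottom.
have : bottom F (wedge_pt x (height x)) by rewrite -E F'F; exists x.
by move=> [y _ /wedge_pt_inj[_ z0]]; rewrite -z0 eqxx in xz.
Qed.

Lemma nonflat_wedge_bottom F F' : (forall x, F x -> 0 <= height x) -> ~~ flat F ->
  wedge F <> bottom F'.
Proof.
move=> zF /nonflatP[x Fx xz] E; have := wedge_top zF Fx; rewrite E.
by move=> [y _ /wedge_pt_inj[_ z0]]; rewrite -z0 eqxx in xz.
Qed.

Lemma nonflat_wedge_top F F' : (forall x, F x -> 0 <= height x) -> ~~ flat F ->
  wedge F <> top F'.
Proof.
move=> zF /nonflatP[x Fx xz] E; have := wedge_bottom zF Fx; rewrite E.
by move=> [y _ /wedge_pt_inj[-> z0]]; rewrite z0 eqxx in xz.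
Qed.

(** Over a flat face the bottom copy and the wedge coincide with the top copy. *)
Definition wedge_faces (fs : seq (set 'rV[R]_n.+1 * nat)) : seq (set 'rV[R]_n.+2 * nat) :=
  [seq (top Fk.1, Fk.2) | Fk <- fs] ++
  [seq (bottom Fk.1, Fk.2) | Fk <- fs & ~~ flat Fk.1] ++
  [seq (wedge Fk.1, Fk.2.+1) | Fk <- fs & ~~ flat Fk.1].

Variables (P : set 'rV[R]_n.+1) (d : nat) (fs : seq (set 'rV[R]_n.+1 * nat)).
Hypotheses (heightP : forall x, P x -> 0 <= height x) (fsP : face_list P d fs).

Lemma height_face Fk : Fk \in fs -> forall x, Fk.1 x -> 0 <= height x.
Proof.
have [_ fsE _ _] := fsP => Fkfs.
have [[c [e [_ ->]]] _] := (fsE Fk.1).1 (map_f _ Fkfs).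
by move=> x [Px _]; apply: heightP.
Qed.

Lemma face_list_wedge : face_list (wedge P) d.+1 (wedge_faces fs).
Proof.
have [fs_uniq fsE fs_dim fs_d] := fsP; split.
- rewrite !map_cat -!map_comp !cat_uniq.
  have uf : uniq (map fst (filter (fun Fk => ~~ flat Fk.1) fs)).
    by apply: subseq_uniq fs_uniq; apply/map_subseq/filter_subseq.
  apply/and3P; split.
  + rewrite (map_comp top fst) map_inj_uniq // => F F' E.
    by rewrite -(shadow_top b F) E shadow_top.
  + apply/hasPn => G; rewrite mem_cat => /orP[] /mapP[Fk]; rewrite mem_filter => /andP[fl Fkfs] ->;
      apply/mapP=> -[F'k _ /=].
      by move/esym; apply: nonflat_top_bottom.
    exact: nonflat_wedge_top (height_face Fkfs) fl.
  + rewrite (map_comp bottom fst); apply/and3P; split.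
    * by rewrite map_inj_uniq // => F F' E; rewrite -(shadow_bottom b F) E shadow_bottom.
    * apply/hasPn => G /mapP[Fk]; rewrite mem_filter => /andP[fl Fkfs] ->.
      apply/mapP=> -[F' _ /=]; exact: nonflat_wedge_bottom (height_face Fkfs) fl.
    * rewrite (map_comp wedge fst) map_inj_in_uniq // => F F'.
      move=> /mapP[Fk]; rewrite mem_filter => /andP[_ Fkfs] ->.
      move=> /mapP[F'k]; rewrite mem_filter => /andP[_ F'kfs] -> E.
      have zF := height_face Fkfs; have zF' := height_face F'kfs.
      by rewrite -(shadow_wedge zF) E shadow_wedge.
- move=> G; split.
    rewrite !map_cat -!map_comp !mem_cat => /or3P[] /mapP[Fk]; rewrite ?mem_filter.
    + move=> Fkfs ->; have [Ff [x Fx]] := (fsE Fk.1).1 (map_f _ Fkfs); split.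
        by apply/is_face_wedge => //; exists Fk.1 => //; constructor 1.
      by exists (wedge_pt x (height x)), x.
    + move=> /andP[_ Fkfs] ->; have [Ff [x Fx]] := (fsE Fk.1).1 (map_f _ Fkfs); split.
        by apply/is_face_wedge => //; exists Fk.1 => //; constructor 2.
      by exists (wedge_pt x 0), x.
    + move=> /andP[_ Fkfs] ->; have [Ff [x Fx]] := (fsE Fk.1).1 (map_f _ Fkfs); split.
        by apply/is_face_wedge => //; exists Fk.1 => //; constructor 3.
      by exists (wedge_pt x 0); apply: wedge_bottom => //; apply: height_face.
  move=> [/is_face_wedge-/(_ heightP)[F Ff GF] G0].
  have F0 : F !=set0.
    by move: G0 => [y]; case: GF => -> [x]; [move=> Fx|move=> Fx|move=> [t [Fx]]]; exists x.
  have /mapP[Fk Fkfs FE] := (fsE F).2 (conj Ff F0).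
  rewrite {F}FE in Ff F0 GF; have zF := height_face Fkfs.
  have topG : top Fk.1 \in map fst (wedge_faces fs).
    by rewrite !map_cat mem_cat -!map_comp; apply/orP; left; apply/mapP; exists Fk.
  have [fl|fl] := boolP (flat Fk.1).
    by case: GF => ->; rewrite ?(flat_wedge zF) // -?flat_top.
  rewrite !map_cat -!map_comp !mem_cat; apply/or3P.
  by case: GF => ->; [constructor 1 | constructor 2 | constructor 3];
    apply/mapP; exists Fk; rewrite ?mem_filter ?fl.
- move=> Gk; rewrite !mem_cat => /or3P[] /mapP[Fk]; rewrite ?mem_filter.
  + by move=> Fkfs ->; apply/has_dim_top/fs_dim.
  + by move=> /andP[_ Fkfs] ->; apply/has_dim_bottom/fs_dim.
  + move=> /andP[/nonflatP[x Fx xz] Fkfs] ->.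
    by apply: has_dim_wedge xz (fs_dim _ Fkfs) => //; apply: height_face.
- move=> Gk; rewrite !mem_cat => /or3P[] /mapP[Fk]; rewrite ?mem_filter.
  + by move=> Fkfs ->; apply/leqW/fs_d.
  + by move=> /andP[_ Fkfs] ->; apply/leqW/fs_d.
  + by move=> /andP[_ Fkfs] ->; apply: fs_d.
Qed.

Lemma face_gf_nonflat : \sum_(Fk <- fs | ~~ flat Fk.1) ('X - 1) ^+ Fk.2 =
  face_gf fs xpredT - face_gf fs flat :> {poly int}.
Proof. by rewrite /face_gf [X in _ = X - _](bigID (fun Fk => flat Fk.1)) /= [X in _ = X - _]addrC addrK. Qed.

Lemma face_gf_wedge : face_gf (wedge_faces fs) xpredT =
  (1 + 'X) * face_gf fs xpredT - 'X * face_gf fs flat.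
Proof.
rewrite {1}/face_gf !big_cat !big_map !big_filter /= -/(face_gf fs xpredT).
under [X in _ + (_ + X)]eq_bigr do rewrite exprS.
by rewrite -mulr_sumr face_gf_nonflat; ring.
Qed.

(** The parameter [t] vanishes identically on all bottom copies, and on the top copy
of a face only if that face is flat; the flat and the remaining faces together are
all faces. *)
Lemma face_gf_wedge_b : face_gf (wedge_faces fs) (max_const b%:R) = face_gf fs xpredT.
Proof.
rewrite {1}/face_gf !big_cat !big_map !big_filter_cond /=.
rewrite [X in X + _](eq_bigl (fun Fk => flat Fk.1)); last by move=> Fk; rewrite max_const_top.
rewrite [X in _ + (X + _)](eq_bigl (fun Fk => ~~ flat Fk.1)); last by move=> Fk; rewrite max_const_bottom andbT.
rewrite [X in _ + (_ + X)]big_seq_cond [X in _ + (_ + X)]big1 ?addr0.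
  by rewrite face_gf_nonflat addrC; apply: subrK.
by move=> Fk /and3P[Fkfs fl]; rewrite max_const_wedge //; apply: height_face.
Qed.

(** Faces that contain a point with [t = 0] are excluded, which leaves the top copies
of the faces of height constantly 1. *)
Lemma face_gf_wedge_nb :
  face_gf (wedge_faces fs) (max_const (~~ b)%:R) = face_gf fs (max_const (~~ b)%:R).
Proof.
have [_ fsE _ _] := fsP.
rewrite {1}/face_gf !big_cat !big_map !big_filter_cond /=.
rewrite [X in X + _](eq_bigl (fun Fk => max_const (~~ b)%:R Fk.1)); last by move=> Fk; rewrite max_const_top_nb.
rewrite [X in _ + (X + _)]big_seq_cond [X in _ + (X + _)]big1; last first.
  move=> Fk /and3P[/(map_f fst)/fsE[_ F0] _]; by rewrite max_const_bottom_nb.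
rewrite [X in _ + (_ + X)]big_seq_cond [X in _ + (_ + X)]big1 ?addr0 ?add0r // => Fk /and3P[Fkfs _].
by rewrite max_const_wedge_nb //; [apply: height_face | have [] := (fsE _).1 (map_f _ Fkfs)].
Qed.

End WedgeFaces.

(** * Base polytopes of snakes *)

Section WedgeConv.
Variables (R : realType) (n : nat) (b : bool).
Local Notation wedge_pt := (@wedge_pt R n b).
Local Notation height := (@height R n b).
Local Notation bottom := (@bottom R n b).
Local Notation top := (@top R n b).
Local Notation wedge := (@wedge R n b).

(** A point of the wedge at relative height [a] over a convex combination is the
mixture, with weights [1 - a] and [a], of the same combination of the bottoms and
of the tops. *)
Lemma conv_wedge (V : set 'rV[R]_n.+1) : (forall v, V v -> 0 <= height v) ->
  conv (bottom V `|` top V) = wedge (conv V).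
Proof.
move=> zV; apply/seteqP; split=> y /=.
  move=> [m [p [w [pV w0 w1 ->]]]].
  have /choice[q qE] : forall i, exists vt,
      [/\ V vt.1, 0 <= vt.2 <= height vt.1 & p i = wedge_pt vt.1 vt.2].
    move=> i; have [[v Vv <-]|[v Vv <-]] := pV i; [exists (v, 0)|exists (v, height v)];
      by split; rewrite //= lexx zV.
  exists (\sum_i w i *: (q i).1), (\sum_i w i * (q i).2); split.
  - by exists m, (fun i => (q i).1), w; split=> // i; have [] := qE i.
  - rewrite -(affine_fun_comb _ (height_affine R n b) w1) sumr_ge0 /=.
      by apply: ler_sum => i _; apply: ler_wpM2l => //; have [_ /andP[]] := qE i.
    by move=> i _; apply: mulr_ge0 => //; have [_ /andP[]] := qE i.
  - by rewrite -wedge_pt_comb //; apply: eq_bigr => i _; have [_ _ <-] := qE i.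
move=> [_ [t [[m [p [w [pV w0 w1 ->]]]] tz ->]]].
set x := \sum_i w i *: p i in tz *.
have [a a01 tE] : exists2 a, 0 <= a <= 1 & t = a * height x.
  (* The relative height is arbitrary over a degenerate segment. *)
  have [z0|z0] := eqVneq (height x) 0.
    by exists 0; [rewrite lexx ler01 | move: tz; rewrite z0; lra].
  exists (t / height x); last by rewrite divfK.
  have zx : 0 < height x by rewrite lt_neqAle eq_sym z0; case/andP: tz; apply: le_trans.
  by rewrite ler_pdivlMr // mul0r ler_pdivrMr // mul1r.
pose p' i := match split i with inl j => wedge_pt (p j) 0 | inr j => wedge_pt (p j) (height (p j)) end.
pose w' i := match split i with inl j => (1 - a) * w j | inr j => a * w j end.
have splitl (i : 'I_m) : split (lshift m i) = inl i by exact: (unsplitK (inl i)).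
have splitr (i : 'I_m) : split (rshift m i) = inr i by exact: (unsplitK (inr i)).
exists (m + m)%N, p', w'; split.
- by move=> i; rewrite /p'; case: split => j; [left|right]; exists (p j).
- by move=> i; rewrite /w'; case: split => j; apply: mulr_ge0 => //; lra.
- rewrite big_split_ord /= /w'; under eq_bigr do rewrite splitl.
  under [X in _ + X]eq_bigr do rewrite splitr.
  by rewrite -!mulr_sumr w1; ring.
- rewrite big_split_ord /= /p' /w'; under [in RHS]eq_bigr do rewrite splitl -scalerA.
  under [X in _ + X]eq_bigr do rewrite splitr -scalerA.
  rewrite -!scaler_sumr !wedge_pt_comb // (affine_fun_comb _ (height_affine R n b) w1).
  rewrite -/x big1; last by move=> i _; rewrite mulr0.
  rewrite !wedge_ptE scale0r addr0 [X in _ = _ + X]scalerDr addrA -scalerDl subrK scale1r.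
  by rewrite [in RHS]scalerA tE.
Qed.

Lemma wedge_pt_lift x t i :
  wedge_pt x t ord0 (lift ord_max i) = x ord0 i - (-1) ^+ b * (i == ord_max)%:R * t.
Proof.
rewrite wedge_ptE mxE [X in X + _]mxE embed_lift !mxE !eqxx lift_neq_max /=.
rewrite (inj_eq (@lift_inj _ _)) mulr0 addr0 sub0r mulrN; congr (_ + _).
by rewrite mulrN mulrC.
Qed.

End WedgeConv.

Section BasePolytope.
Variables (R : realType).

Definition indicator n (B : {set 'I_n}) : 'rV[R]_n := \sum_(i in B) delta_mx ord0 i.

Lemma indicatorE n (B : {set 'I_n}) i : indicator B ord0 i = (i \in B)%:R.
Proof.
rewrite summxE; have [iB|iB] := boolP (i \in B).
  rewrite (bigD1 i) //= mxE !eqxx big1 ?addr0 // => j /andP[_ ji].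
  by rewrite mxE eqxx eq_sym (negbTE ji).
rewrite big1 // => j jB; rewrite mxE eqxx /=; case: eqP => // ij.
by rewrite ij jB in iB.
Qed.

Lemma base_polytope_01 n (M : matroid 'I_n) (x : 'rV[R]_n) i :
  base_polytope R M x -> 0 <= x ord0 i <= 1.
Proof.
move=> [m [p [w [pM w0 w1 ->]]]]; rewrite summxE.
have p01 j : 0 <= p j ord0 i <= 1.
  by have [B _ <-] := pM j; rewrite -/(indicator B) indicatorE; case: (_ \in _); rewrite ?lexx ?ler01.
apply/andP; split.
  by apply: sumr_ge0 => j _; rewrite mxE mulr_ge0 //; have /andP[] := p01 j.
rewrite -w1; apply: ler_sum => j _; rewrite mxE ler_piMr //; by have /andP[] := p01 j.
Qed.

Section Extensions.
Variables (n : nat) (M : matroid 'I_n.+1).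
Implicit Types B : {set 'I_n.+1}.

Lemma height_indicator b B : @height R n b (indicator B) = (b (+) (ord_max \in B))%:R.
Proof. by rewrite /height indicatorE; case: b; case: (_ \in _); rewrite //= ?subrr ?subr0. Qed.

Lemma indicator_ext (b : bool) B (K : {set 'I_n.+2}) (t : R) :
  (ord_max \in K)%:R = b%:R + (-1) ^+ b * t :> R ->
  (forall i, (lift ord_max i \in K)%:R = (i \in B)%:R - (-1) ^+ b * (i == ord_max)%:R * t :> R) ->
  indicator K = wedge_pt b (indicator B) t.
Proof.
move=> Emax Elift; apply/rowP=> i; rewrite indicatorE.
case: (unliftP ord_max i) => [j|] ->; first by rewrite wedge_pt_lift indicatorE Elift.
by rewrite wedge_pt_max Emax.
Qed.

(** The bottoms and tops of the vertices are the vertices of the extension: the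
bottom over [B] is its unmodified copy, to which a series extension adds the new
element. The height of a vertex is 0 or 1, and it is 1 precisely when [B] also
yields a modified basis, which is then the top. *)
Lemma base_polytope_ext b : base_polytope R (if b then series_ext M else parallel_ext M) =
  wedge b (base_polytope R M).
Proof.
have E0 B : indicator (if b then ord_max |: incl B else incl B) = wedge_pt b (indicator B) 0.
  by apply: indicator_ext => [|i]; rewrite mulr0 ?addr0 ?subr0; case: b; rewrite ?inE ?inclE ?eqxx.
have E1 B : b (+) (ord_max \in B) ->
    indicator (if b then incl (ord_max |: B) else ord_max |: incl (B :\ ord_max)) =
    wedge_pt b (indicator B) (height b (indicator B)).
  move=> {E0} bB; rewrite height_indicator bB.
  apply: indicator_ext => [|i]; first by case: b bB => _; rewrite ?inE ?inclE ?eqxx /=; lra.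
  case: b bB => /= eB; [rewrite mem_incl !inE | rewrite !inE lift_neq_max mem_incl !inE] => /=.
    by case: eqVneq => [->|_] /=; rewrite ?(negbTE eB) /=; lra.
  by case: eqVneq => [->|_] /=; rewrite ?eB /=; lra.
rewrite -conv_wedge; last first.
  by move=> _ [B _ <-]; rewrite -/(indicator B) height_indicator ler0n.
congr conv; apply/seteqP; split=> y /=.
  move=> [K]; case: b E0 E1 => E0 E1; rewrite /= inE => /orP[] /imsetP[B]; rewrite ?inE.
  - by move=> BM -> <-; left; exists (indicator B); [exists B | rewrite -E0].
  - move=> /andP[BM eB] -> <-; right; exists (indicator B); first by exists B.
    by rewrite -E1.
  - by move=> BM -> <-; left; exists (indicator B); [exists B | rewrite -E0].
  - move=> /andP[BM eB] -> <-; right; exists (indicator B); first by exists B.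
    by rewrite -E1.
have bot B : B \in bases M -> [set indicator K | K in [set` bases (if b then series_ext M else parallel_ext M)]]
     (wedge_pt b (indicator B) 0).
  move=> BM; rewrite -E0; eexists; last by [].
  by case: b {E0 E1}; rewrite /= inE; apply/orP; left; apply: imset_f.
case=> -[_ [B BM <-] <-]; rewrite -/(indicator B); first exact: bot.
have [bB|bB] := boolP (b (+) (ord_max \in B)); last first.
  by rewrite height_indicator (negbTE bB); apply: bot.
rewrite -E1 //; eexists; last by [].
case: b bB {E0 E1 bot} => /= eB; rewrite inE; apply/orP; right; apply/imsetP; exists B => //.
  by rewrite inE eB andbT.
by rewrite inE eB andbT.
Qed.

End Extensions.

Lemma base_polytope_coloop : base_polytope R coloop = [set indicator (finset.setTfor 'I_1)].
Proof.
apply/seteqP; split=> x /=.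
  move=> [m [p [w [pM w0 w1 ->]]]]; rewrite -[RHS]scale1r -w1 scaler_suml.
  by apply: eq_bigr => i _; have [B] := pM i; rewrite /= inE => /eqP-> <-.
move=> ->; exists 1%N, (fun=> indicator (finset.setTfor 'I_1)), (fun=> 1); split=> //.
- by move=> _; exists (finset.setTfor 'I_1) => //=; rewrite inE.
- by rewrite big_ord1.
- by rewrite big_ord1 scale1r.
Qed.

Lemma face_list_point n (x : 'rV[R]_n) : face_list [set x] 0 [:: ([set x], 0%N)].
Proof.
split=> //.
- move=> F; rewrite inE; split=> [/eqP->|[[c [e [_ ->]]]] [y [/= yx ye]]].
    split; last by exists x.
    exists 0, 0; split=> [y _|]; first by rewrite big1 // => i _; rewrite mxE mul0r.
    apply/seteqP; split=> y /=; last by case.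
    by move=> ->; split=> //; rewrite big1 // => i _; rewrite mxE mul0r.
  by apply/eqP/seteqP; split=> z /= => [[]|->] //; split=> //; rewrite -yx.
- move=> _ /predU1P[->|//] /=; exists x, 0%VS; split; first by rewrite dimv0.
  apply/seteqP; split=> y /=.
    move=> [m [p [w [px w1 ->]]]]; exists 0; first by rewrite /= mem0v.
    rewrite addr0 -[LHS]scale1r -w1 scaler_suml.
    by apply: eq_bigr => i _; rewrite (px i).
  by move=> [u /=]; rewrite memv0 => /eqP-> <-; rewrite addr0; apply: sub_affine_hull.
- by move=> _ /predU1P[->|//].
Qed.

Lemma eq_bases_base_polytope n (M N : matroid 'I_n) :
  bases M = bases N -> base_polytope R M = base_polytope R N.
Proof. by move=> E; rewrite /base_polytope E. Qed.

Lemma height_base_polytope n (M : matroid 'I_n.+1) b x :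
  base_polytope R M x -> 0 <= height b x.
Proof.
by move/base_polytope_01 => /(_ ord_max) /andP[? ?]; rewrite /height; case: b; rewrite ?subr_ge0.
Qed.

(** The enumeration is transported along the wedges, starting from a single point. *)
Lemma snake_face_list s k : exists2 fs,
  face_list (base_polytope R (snake_prefix s k)) k.+1 fs &
  (face_gf fs xpredT, face_gf fs (max_const 0), face_gf fs (max_const 1)) = face_polys s k.
Proof.
elim: k => [|k [fs fsP fsE]].
  rewrite /= (eq_bases_base_polytope U12_parallel) (base_polytope_ext coloop false).
  have fsP := face_list_point (indicator (finset.setTfor 'I_1)); rewrite -base_polytope_coloop in fsP.
  have zP x := @height_base_polytope _ coloop false x.
  exists (wedge_faces false [:: (base_polytope R coloop, 0%N)]); first exact: face_list_wedge.
  rewrite face_gf_wedge (face_gf_wedge_b zP fsP) (face_gf_wedge_nb zP fsP).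
  have c0 : max_const 0 (base_polytope R coloop) = false.
    apply/asboolP; rewrite base_polytope_coloop => /(_ _ erefl)/eqP.
    by rewrite indicatorE inE oner_eq0.
  have c1 : max_const 1 (base_polytope R coloop).
    by apply/asboolP => x; rewrite base_polytope_coloop => ->; rewrite indicatorE inE.
  rewrite /face_gf !big_cons !big_nil /= c0 c1 expr0 mulr0 subr0 !addr0.
  by rewrite mulr1.
have zP b x := @height_base_polytope _ (snake_prefix s k) b x.
exists (wedge_faces (nth false s k) fs).
  have -> : base_polytope R (snake_prefix s k.+1) =
      wedge (nth false s k) (base_polytope R (snake_prefix s k)) by rewrite -base_polytope_ext.
  exact: face_list_wedge (zP _) fsP.
rewrite /= -fsE; case: (nth _ _ _).
  have := face_gf_wedge_nb (zP true) fsP; have := face_gf_wedge_b (zP true) fsP.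
  by rewrite face_gf_wedge /= => -> ->.
have := face_gf_wedge_nb (zP false) fsP; have := face_gf_wedge_b (zP false) fsP.
by rewrite face_gf_wedge /= => -> ->.
Qed.

Lemma polytope_h_snake s k i :
  polytope_h (base_polytope R (snake_prefix s k)) k.+1 i = (face_polys s k).1.1`_i.
Proof.
by have [fs fsP <-] := snake_face_list s k; rewrite /polytope_h (polytope_h_polyE fsP).
Qed.

End BasePolytope.

Theorem corollary7 (R : realType) (d : nat) (s : seq bool) :
  (1 <= d)%N -> size s = (d - 1)%N ->
  forall j : nat, (j <= d)%N ->
    \sum_(i < j.+1) polytope_h (base_polytope R (snake s)) d i
      <= \sum_(i < j.+1) indep_h (snake s) i.
Proof.
move=> d_gt0 sd j _.
have -> : d = (size s).+1 by rewrite sd subn1 prednK.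
under eq_bigr do rewrite polytope_h_snake.
under [leRHS]eq_bigr do rewrite indep_h_snake.
exact: face_indep_dominance.
Qed.
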